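(* Let $V$ be a Banach $\mathbb O$-bimodule, let $T\in\mathscr B_{\mathcal{RO}}(V)$, let $J\in\mathbb S$ and let $s\in\mathbb C_J$ with $|s|>\|T\|$. Then: (1) For every $x\in\mathbb C_J(V)$ the series $\sum_{n\ge0}\big(T^{\circledcirc n}\odot s^{-1-n}\big)(x)$ and $\sum_{n\ge 0}[T,T^{\circledcirc n},xs^{-1-n}]_{\circledcirc}$ converge in norm and $$(R_s-T)\Big(\sum_{n\ge0}\big(T^{\circledcirc n}\odot s^{-1-n}\big)(x)\Big)=x+\sum_{n\ge0}[T,T^{\circledcirc n},xs^{-1-n}]_{\circledcirc}.$$ (2) For every $x\in V$ the series $\sum_{n\ge0}\big(s^{-1-n}\odot T^{n\circledcirc}\big)(y)$ (for any $y\in V$) and $\sum_{n\ge0}[T^{n\circledcirc},T,x]_{\circledcirc}\,s^{-1-n}$ converge in norm and $$\pi_J\sum_{n\ge0}\big(s^{-1-n}\odot T^{n\circledcirc}\big)\big((R_s-T)(x)\big)=\pi_J x+\pi_J\sum_{n\ge0}[T^{n\circledcirc},T,x]_{\circledcirc}\,s^{-1-n}.$$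
   Context: $\mathbb O$ is the real octonion algebra with basis $e_0=1,e_1,\dots,e_7$, conjugation $\bar x$ and norm $|x|$; $\mathbb S=\{J\in\mathbb O:J^2=-1\}$ and $\mathbb C_J=\mathbb R+\mathbb RJ$. An $\mathbb O$-bimodule is a real vector space $M$ with real-bilinear left and right multiplications by $\mathbb O$ (with $1x=x1=x$) whose associators $[p,q,x]=(pq)x-p(qx)$, $[p,x,q]=(px)q-p(xq)$, $[x,p,q]=(xp)q-x(pq)$ satisfy $[p,q,x]=[q,x,p]=[x,p,q]=-[q,p,x]$ for all $p,q\in\mathbb O,x\in M$. Its real part is $\operatorname{Re}M=\{m\in M: pm=mp,\ [p,q,m]=0\ \forall p,q\in\mathbb O\}$; every $x\in M$ decomposes uniquely as $x=\sum_{i=0}^7 e_ix_i$ with $x_i\in\operatorname{Re}M$, and $\operatorname{Re}x:=x_0$ (equivalently $\operatorname{Re}x=\tfrac5{12}x-\tfrac1{12}\sum_{i=1}^7e_ixe_i$). For $J\in\mathbb S$, $\mathbb C_J(M)=\operatorname{Re}M\oplus J\operatorname{Re}M$ and $\pi_J:M\to\mathbb C_J(M)$, $\pi_J(x)=\operatorname{Re}x+J\operatorname{Re}(\bar Jx)$. A Banach $\mathbb O$-bimodule is an $\mathbb O$-bimodule $V$ with a complete norm such that $\|px\|=\|xp\|=|p|\,\|x\|$. $\mathscr B_{\mathbb R}(V)$ denotes the bounded real-linear operators on $V$, with ordinary composition $TS=T\circ S$ and powers $T^n$ ($T^0=\mathcal I$); for $s\in\mathbb O$, $R_s\in\mathscr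 B_{\mathbb R}(V)$ is $R_sv=vs$. For a real-linear $f$ and $p\in\mathbb O$ set $B_p(f,x)=f(x)p-f(xp)$; $f$ is right para-linear if $\operatorname{Re}B_p(f,x)=0$ for all $p,x$, and octonionic linear if $f(xp)=f(x)p$ for all $p,x$. $\mathscr B_{\mathcal{RO}}(V)$ (resp. $\mathscr B_{\mathbb O}(V)$) is the set of bounded right para-linear (resp. octonionic linear) operators; it is an $\mathbb O$-bimodule via $(p\odot f)(x)=pf(x)+B_p(f,x)$, $(f\odot p)(x)=f(px)-B_p(f,x)$. For real-linear $h:\operatorname{Re}V\to V$, $\operatorname{ext}h\in\mathscr B_{\mathcal{RO}}(V)$ is $(\operatorname{ext}h)(\sum_i x_ie_i)=\sum_i h(x_i)e_i$ ($x_i\in\operatorname{Re}V$); for real-linear $h:V\to\operatorname{Re}V$, $(\operatorname{lif}h)(x)=\sum_{i=0}^7h(x\bar e_i)e_i$. For $T\in\mathscr B_{\mathbb R}(V)$: $T^{\circledcirc n}=\operatorname{ext}(T^n|_{\operatorname{Re}V})$, $T^{n\circledcirc}=\operatorname{lif}(\operatorname{Re}\circ T^n)$. For $f,g\in\mathscr B_{\mathcal{RO}}(V)$ the regular composition is $f\circledcirc g=\operatorname{ext}((f\circ g)|_{\operatorname{Re}V})$ (equivalently $\operatorname{lif}(\operatorname{Re}\circ f\circ g)$), and the composition associator is $[f,g,x]_{\circledcirc}=(f\circledcirc g)(x)-f(g(x))$. *)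

(* Defs.v *)
From HB Require Import structures.
From mathcomp Require Import all_boot all_order all_algebra.
From mathcomp Require Import all_classical all_reals all_analysis.
Set Implicit Arguments. Unset Strict Implicit. Unset Printing Implicit Defensive.
Import Order.TTheory GRing.Theory Num.Theory.
Import numFieldNormedType.Exports.
Local Open Scope classical_set_scope.
Local Open Scope ring_scope.

(* The real octonion algebra O, as R^8 with basis e_0 = 1, e_1..e_7.  *)
(* Multiplication table (Cayley-Dickson / Wikipedia convention):      *)
(*   e_i e_i = -1 (i>0), e_0 neutral, e_i e_j = +- e_(i xor j), with   *)
(*   e_a e_b = e_c = - e_b e_a for the oriented lines                 *)
(*   (1,2,3),(1,4,5),(1,7,6),(2,4,6),(2,5,7),(3,4,7),(3,6,5)          *)
(*   and their cyclic rotations.                                      *)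

Definition oct_lines : seq (nat * nat * nat) :=
  [:: (1,2,3); (1,4,5); (1,7,6); (2,4,6); (2,5,7); (3,4,7); (3,6,5)]%N.

Definition oct_idx (i j : 'I_8) : 'I_8 := inord (Nat.lxor i j).

(* true iff e_i e_j = - e_(oct_idx i j) *)
Definition oct_neg (i j : 'I_8) : bool :=
  if (i == 0%N :> nat) || (j == 0%N :> nat) then false
  else if i == j then true
  else ~~ has (fun t : nat * nat * nat =>
                 let: (a, b, c) := t in
                 [|| ((i == a :> nat) && (j == b :> nat)),
                     ((i == b :> nat) && (j == c :> nat)) |
                     ((i == c :> nat) && (j == a :> nat))]) oct_lines.

Section Octonions.
Variable R : realType.

Definition oct := 'rV[R]_8.

Definition oe (i : 'I_8) : oct := \row_(j < 8) (if j == i then 1 else 0).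
Definition oone : oct := oe 0.

Definition omul (x y : oct) : oct :=
  \row_(k < 8) \sum_(i < 8) \sum_(j < 8)
     (if oct_idx i j == k then (if oct_neg i j then -1 else 1) * (x 0 i * y 0 j)
      else 0).

Definition oconj (x : oct) : oct := \row_(i < 8) (if i == 0 then x 0 i else - x 0 i).

Definition onorm (x : oct) : R := Num.sqrt (\sum_(i < 8) (x 0 i) ^+ 2).

Definition octinv (x : oct) : oct := (onorm x ^+ 2)^-1 *: oconj x.

(* x^n (power associativity makes this unambiguous) *)
Definition opow (x : oct) (n : nat) : oct := iter n (omul x) oone.

Definition in_S (J : oct) : Prop := omul J J = - oone.

Definition in_CJ (J s : oct) : Prop := exists a b : R, s = a *: oone + b *: J.

End Octonions.

(* O-bimodules over a real normed space (Banach O-bimodule when V is   *)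
(* complete and the norm axioms hold).                                 *)

Record BanachOBimodule (R : realType) (V : normedModType R) := {
  lm : oct R -> V -> V ;
  rm : V -> oct R -> V ;
  lm_linl : forall (a : R) (p q : oct R) (x : V),
      lm (a *: p + q) x = a *: lm p x + lm q x ;
  lm_linr : forall (p : oct R) (a : R) (x y : V),
      lm p (a *: x + y) = a *: lm p x + lm p y ;
  rm_linl : forall (x : V) (a : R) (p q : oct R),
      rm x (a *: p + q) = a *: rm x p + rm x q ;
  rm_linr : forall (p : oct R) (a : R) (x y : V),
      rm (a *: x + y) p = a *: rm x p + rm y p ;
  lm_one : forall x : V, lm (oone R) x = x ;
  rm_one : forall x : V, rm x (oone R) = x ;
  (* [p,q,x] = [q,x,p] *)
  assoc_1 : forall (p q : oct R) (x : V),
      lm (omul p q) x - lm p (lm q x) = rm (lm q x) p - lm q (rm x p) ;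
  (* [q,x,p] = [x,p,q] *)
  assoc_2 : forall (p q : oct R) (x : V),
      rm (lm q x) p - lm q (rm x p) = rm (rm x p) q - rm x (omul p q) ;
  (* [x,p,q] = -[q,p,x] *)
  assoc_3 : forall (p q : oct R) (x : V),
      rm (rm x p) q - rm x (omul p q) = - (lm (omul q p) x - lm q (lm p x)) ;
  norm_lm : forall (p : oct R) (x : V), `|lm p x| = onorm p * `|x| ;
  norm_rm : forall (p : oct R) (x : V), `|rm x p| = onorm p * `|x|
}.

Section Bimod.
Variables (R : realType) (V : normedModType R) (M : BanachOBimodule V).

Local Notation lm := (lm M).
Local Notation rm := (rm M).
Local Notation e := (@oe R).

Definition ReV : set V :=
  [set m | (forall p, lm p m = rm m p) /\
           (forall p q, lm (omul p q) m - lm p (lm q m) = 0)].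

Definition reV (x : V) : V :=
  (5 / 12 : R) *: x - (1 / 12 : R) *: \sum_(i < 8 | i != 0) rm (lm (e i) x) (e i).

Definition in_CJV (J : oct R) (x : V) : Prop :=
  exists a b, ReV a /\ ReV b /\ x = a + lm J b.

Definition piJ (J : oct R) (x : V) : V := reV x + lm J (reV (lm (oconj J) x)).

Definition Rs (s : oct R) (v : V) : V := rm v s.

Definition Bp (p : oct R) (f : V -> V) (x : V) : V := rm (f x) p - f (rm x p).

Definition right_paralinear (f : V -> V) : Prop :=
  forall (p : oct R) (x : V), reV (Bp p f x) = 0.

Definition bounded_op (f : V -> V) : Prop :=
  exists c : R, forall x, `|f x| <= c * `|x|.

Definition opnorm (f : V -> V) : R :=
  sup [set `|f x| | x in [set x : V | `|x| <= 1]].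

Definition olact (p : oct R) (f : V -> V) (x : V) : V := lm p (f x) + Bp p f x.
Definition oract (f : V -> V) (p : oct R) (x : V) : V := f (lm p x) - Bp p f x.

(* oext h (sum_i x_i e_i) = sum_i h(x_i) e_i, where the i-th real        *)
(* component of x is x_i = Re(x conj(e_i)).                              *)
Definition oext (h : V -> V) (x : V) : V :=
  \sum_(i < 8) rm (h (reV (rm x (oconj (e i))))) (e i).

Definition olif (h : V -> V) (x : V) : V :=
  \sum_(i < 8) rm (h (rm x (oconj (e i)))) (e i).

Definition circ_pow (T : V -> V) (n : nat) : V -> V := oext (iter n T).
Definition pow_circ (T : V -> V) (n : nat) : V -> V := olif (reV \o iter n T).

Definition rcomp (f g : V -> V) : V -> V := oext (f \o g).
Definition comp_assoc (f g : V -> V) (x : V) : V := rcomp f g x - f (g x).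

End Bimod.

(* Main.v *)
Require Import Defs.
From HB Require Import structures.
From mathcomp Require Import all_boot all_order all_algebra.
From mathcomp Require Import all_classical all_reals all_analysis.
From mathcomp Require Import ring lra.
Set Implicit Arguments.
Unset Strict Implicit.
Unset Printing Implicit Defensive.
Import Order.TTheory GRing.Theory Num.Theory.
Import numFieldNormedType.Exports.
Local Open Scope classical_set_scope.
Local Open Scope ring_scope.

(* Put p_n = s^(-1-n) and q = s^(-1).  On the slice x = a + J b with a, b real,
   the n-th term of the first series is u_n = T^n(a) p_n + T^n(b) (J p_n), and the
   n-th composition associator is u_(n+1) s - T u_n, so (1) telescopes.  For (2),
   apply pi_J termwise: with
   Phi_n(x, p) = Re T^n(x p) - J Re T^n(x (p J)), the two terms become
   Phi_n(x, q^n) - Phi_n(T x, p_n) and Phi_(n+1)(x, p_n) - Phi_n(T x, p_n), so the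
   difference telescopes from Phi_0(x, 1) = pi_J x to 0.

   Part (2) needs the structure of octonion bimodules, namely that Re x is real
   and x = sum_i Re(x conj(e_i)) e_i.  The left multiplications L_i by the imaginary
   units satisfy the Clifford relations.  Let F_i be half of the sum of L_a L_b
   over the three oriented lines e_a e_b = e_i, minus L_i / 2.  The bimodule axioms
   give [R_i, L_j] = [F_i, L_j], so the defect D = R_i - F_i commutes with all L_j;
   commuting R_i^2 = -1 with some L_j then forces D = 0 and L_1 ... L_7 = -1.
   Hence every R_i is a polynomial in the L_j, 8 Re = 1 - sum L_a L_b L_c over the
   seven lines, and what remains are identities in the Clifford algebra modulo
   L_1 ... L_7 = -1, which are decided by reflection. *)

(* [Num.Theory] has a lemma of the same name. *)
Local Notation ReV := Defs.ReV.

(** * Octonions *)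

(* [oct_neg] on plain naturals, so that table lookups can be computed. *)
Definition oneg (i j : nat) : bool :=
  if (i == 0)%N || (j == 0)%N then false
  else if i == j then true
  else ~~ has (fun t : nat * nat * nat =>
                 let: (a, b, c) := t in
                 [|| ((i == a) && (j == b)), ((i == b) && (j == c)) |
                     ((i == c) && (j == a))]) oct_lines.

Lemma oct_negE (i j : 'I_8) : oct_neg i j = oneg i j.
Proof. by []. Qed.

(** Index identities on ['I_8] are moved to naturals, where [vm_compute] can run through the whole
    multiplication table. *)
Lemma all_iota8 (P : nat -> bool) : all P (iota 0 8) -> forall i : 'I_8, P i.
Proof. by move=> /allP h i; apply: h; rewrite mem_iota add0n ltn_ord. Qed.

Lemma all2_iota8 (P : nat -> nat -> bool) :
  all (fun i => all (P i) (iota 0 8)) (iota 0 8) -> forall i j : 'I_8, P i j.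
Proof. by move=> /all_iota8 h i j; apply: (@all_iota8 (P i)). Qed.

Lemma lxorxx (i : 'I_8) : Nat.lxor i i = 0%N.
Proof. by apply/eqP; apply: (@all_iota8 (fun i => Nat.lxor i i == 0)%N); vm_compute. Qed.

Lemma lxorC (i j : 'I_8) : Nat.lxor i j = Nat.lxor j i.
Proof.
by apply/eqP; apply: (@all2_iota8 (fun i j => Nat.lxor i j == Nat.lxor j i)); vm_compute.
Qed.

Lemma lxor_lt8 (i j : 'I_8) : (Nat.lxor i j < 8)%N.
Proof. by apply: (@all2_iota8 (fun i j => Nat.lxor i j < 8)%N); vm_compute. Qed.

Lemma val_oct_idx (i j : 'I_8) : oct_idx i j = Nat.lxor i j :> nat.
Proof. by rewrite /oct_idx inordK ?lxor_lt8. Qed.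

Section OctonionAlgebra.
Variable R : realType.
Implicit Types (x y z p q : oct R) (i j k : 'I_8).

Lemma oeE i j : oe R i 0 j = (j == i)%:R.
Proof. by rewrite mxE; case: eqP. Qed.

Lemma oct_basis x : x = \sum_i x 0 i *: oe R i.
Proof.
apply/rowP => k; rewrite summxE (bigD1 k) //= big1 ?addr0; last first.
  by move=> i ik; rewrite mxE oeE eq_sym (negPf ik) mulr0.
by rewrite mxE oeE eqxx mulr1.
Qed.

Lemma omul_linr x (a : R) y z : omul x (a *: y + z) = a *: omul x y + omul x z.
Proof.
apply/rowP => k; rewrite !mxE mulr_sumr -big_split; apply: eq_bigr => i _ /=.
rewrite mulr_sumr -big_split; apply: eq_bigr => j _ /=.
by rewrite !mxE; case: ifP => _; [ring | rewrite mulr0 addr0].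
Qed.

Lemma omul_linl x (a : R) y z : omul (a *: y + z) x = a *: omul y x + omul z x.
Proof.
apply/rowP => k; rewrite !mxE mulr_sumr -big_split; apply: eq_bigr => i _ /=.
rewrite mulr_sumr -big_split; apply: eq_bigr => j _ /=.
by rewrite !mxE; case: ifP => _; [ring | rewrite mulr0 addr0].
Qed.

HB.instance Definition _ x :=
  GRing.isLinear.Build R (oct R) (oct R) *:%R (@omul R x) (omul_linr x).

(** Swapping the arguments lets the left factor carry a canonical linear structure; [lmr] and [rmr]
    below serve the same purpose for the bimodule actions. *)
Definition omulr x y := omul y x.
HB.instance Definition _ x :=
  GRing.isLinear.Build R (oct R) (oct R) *:%R (omulr x) (omul_linl x).

Lemma omulDl x y z : omul (x + y) z = omul x z + omul y z.
Proof. exact: (raddfD (omulr z)). Qed.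
Lemma omulZl (a : R) x y : omul (a *: x) y = a *: omul x y.
Proof. exact: (linearZZ (omulr y)). Qed.
Lemma omul_suml I (r : seq I) (P : pred I) (F : I -> oct R) y :
  omul (\sum_(i <- r | P i) F i) y = \sum_(i <- r | P i) omul (F i) y.
Proof. exact: (raddf_sum (omulr y)). Qed.

Lemma omul_oe i j :
  omul (oe R i) (oe R j) = (-1) ^+ oct_neg i j *: oe R (oct_idx i j).
Proof.
apply/rowP => k; rewrite !mxE (bigD1 i) //= (bigD1 j) //= !mxE !eqxx.
rewrite [X in _ + X + _]big1 ?addr0; last first.
  by move=> j' /negPf h; rewrite !mxE h !mulr0; case: ifP.
rewrite big1 ?addr0; last first.
  move=> i' /negPf h; rewrite big1 // => j' _.
  by rewrite !mxE h !mul0r !mulr0; case: ifP.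
rewrite eq_sym; case: ifP => _; last by rewrite mulr0.
by case: (oct_neg i j) => /=; rewrite ?expr1 ?expr0; ring.
Qed.

Lemma omul1l x : omul (oone R) x = x.
Proof.
rewrite [in LHS](oct_basis x) linear_sum [in RHS](oct_basis x).
apply: eq_bigr => i _; rewrite linearZ /= omul_oe; congr (_ *: _).
rewrite oct_negE /= scale1r; congr (oe _ _); apply: val_inj.
rewrite /= val_oct_idx; apply/eqP.
have /all_iota8/(_ i) : all (fun i : nat => Nat.lxor 0%N i == i) (iota 0 8) by vm_compute.
by [].
Qed.

Lemma omul1r x : omul x (oone R) = x.
Proof.
rewrite [in LHS](oct_basis x) omul_suml [in RHS](oct_basis x).
apply: eq_bigr => i _; rewrite omulZl omul_oe; congr (_ *: _).
rewrite oct_negE /oneg orbT scale1r; congr (oe _ _); apply: val_inj.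
rewrite /= val_oct_idx; apply/eqP.
have /all_iota8/(_ i) : all (fun i : nat => Nat.lxor i 0%N == i) (iota 0 8) by vm_compute.
by [].
Qed.

Lemma oct_idx_eq0 i j : (oct_idx i j == 0) = (i == j).
Proof.
rewrite -!val_eqE /= val_oct_idx.
have /all2_iota8/(_ i j)/eqP : all (fun i : nat => all (fun j : nat =>
  (Nat.lxor i j == 0%N) == (i == j)) (iota 0 8)) (iota 0 8) by vm_compute.
by [].
Qed.

(** Only diagonal products reach e_0, because i xor j = 0 forces i = j. *)
Lemma Re_omul x y : omul x y 0 0 = \sum_i (-1) ^+ (i != 0) * (x 0 i * y 0 i).
Proof.
rewrite mxE; apply: eq_bigr => i _; rewrite (bigD1 i) //= oct_idx_eq0 eqxx.
rewrite big1 ?addr0; last by move=> j ji; rewrite oct_idx_eq0 eq_sym (negPf ji).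
have -> : oct_neg i i = (i != 0).
  by rewrite oct_negE /oneg orbb -val_eqE /= eqxx; case: (_ == 0%N).
by case: (i != 0) => /=; ring.
Qed.

Lemma Re_omulC x y : omul x y 0 0 = omul y x 0 0.
Proof. by rewrite !Re_omul; apply: eq_bigr => i _; ring. Qed.

Lemma Re_oe i : oe R i 0 0 = (i == 0)%:R.
Proof. by rewrite oeE eq_sym. Qed.

Lemma octZE (a : R) x k : (a *: x) 0 k = a * x 0 k.
Proof. by rewrite mxE. Qed.

(** Octonion associators are purely imaginary. This replaces associativity throughout: identities
    are tested after taking real parts. Trilinearity leaves a sign check on basis triples. *)
Lemma Re_omulA x y z : omul (omul x y) z 0 0 = omul x (omul y z) 0 0.
Proof.
rewrite (oct_basis x) !omul_suml !summxE; apply: eq_bigr => i _.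
rewrite !omulZl !octZE; congr (_ * _).
rewrite (oct_basis y) linear_sum !omul_suml linear_sum !summxE; apply: eq_bigr => j _.
rewrite linearZ /= !omulZl linearZ !octZE; congr (_ * _).
rewrite (oct_basis z) !linear_sum !summxE; apply: eq_bigr => k _.
rewrite !linearZ /= !octZE; congr (_ * _).
rewrite !omul_oe linearZ omulZl /= !omul_oe !scalerA -!signr_addb.
rewrite !octZE !Re_oe !oct_negE -!val_eqE /= !val_oct_idx.
set b1 := _ (+) _; set b2 := _ (+) _.
set c1 := (_ == 0%N); set c2 := (_ == 0%N).
(* The signs are compared only for triples with real product; on other triples they may differ. *)
have : (c1 == c2) && (c1 ==> (b1 == b2)).
  rewrite /b1 /b2 /c1 /c2.
  pose P (i j k : nat) :=
   let c1 := Nat.lxor (Nat.lxor i j) k == 0%N in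
   (c1 == (Nat.lxor i (Nat.lxor j k) == 0%N)) &&
   (c1 ==> (oneg i j (+) oneg (Nat.lxor i j) k == oneg j k (+) oneg i (Nat.lxor j k))).
  apply: (@all_iota8 (P i j)); apply: (@all2_iota8 (fun i j : nat => all (P i j) (iota 0 8))).
  by vm_compute.
by case: c1 => /= /andP[/eqP <-]; rewrite ?mulr0 // => /eqP ->.
Qed.

Lemma oconj_oe i : oconj (oe R i) = (-1) ^+ (i != 0) *: oe R i.
Proof.
apply/rowP => k; rewrite !mxE; have [->|ki] := eqVneq k i; last by rewrite mulr0 oppr0; case: ifP.
by have [_|_] := eqVneq i 0; rewrite /= ?expr1 ?expr0; ring.
Qed.

Lemma Re_omul_conj x i : omul x (oconj (oe R i)) 0 0 = x 0 i.
Proof.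
rewrite Re_omul (bigD1 i) //= big1 ?addr0.
  by rewrite oconj_oe octZE oeE eqxx; case: (i != 0); rewrite /= ?expr1 ?expr0; ring.
by move=> j ji; rewrite oconj_oe octZE oeE (negPf ji) ?mul0r !mulr0.
Qed.

Lemma Re_omul_oe_conj x i : omul (oe R i) x 0 0 *: oconj (oe R i) = x 0 i *: oe R i.
Proof.
rewrite Re_omulC Re_omul (bigD1 i) //= big1 ?addr0.
  rewrite oconj_oe scalerA oeE eqxx.
  by congr (_ *: _); case: (i != 0) => /=; ring.
by move=> j ji; rewrite oeE (negPf ji) ?mul0r !mulr0.
Qed.

(** For i > 0, e_i e_j e_i is e_j if j > 0 differs from i, and -e_j if j = i or j = 0. The totals
    are 6 - 1 = 5 and -7, so the weights 5/12 and -1/12 in [reV] kill imaginary components (5/12 -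
    5/12 = 0) and fix real ones (5/12 + 7/12 = 1). *)
Lemma sum_imag_sandwich j : 
  \sum_(i < 8 | i != 0) omul (omul (oe R i) (oe R j)) (oe R i) =
  (if j == 0 then -7 else 5) *: oe R j.
Proof.
transitivity (\sum_(i < 8 | i != 0)
   (-1) ^+ (oneg i j (+) oneg (Nat.lxor i j) i) *: oe R j).
  apply: eq_bigr => i _; rewrite omul_oe omulZl omul_oe scalerA -signr_addb.
  rewrite !oct_negE val_oct_idx; congr (_ *: oe _ _); apply: val_inj.
  rewrite /= !val_oct_idx; apply/eqP.
  by apply: (@all2_iota8 (fun i j : nat => Nat.lxor (Nat.lxor i j) i == j)); vm_compute.
rewrite -scaler_suml; congr (_ *: _).
rewrite big_mkcond !big_ord_recl big_ord0 /= -val_eqE /=.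
have [-> /=|] := eqVneq j 0.
  rewrite /oneg /= ?expr0 ?expr1; ring.
case: j => -[//|[|[|[|[|[|[|[|//]]]]]]]] ? _ /=; rewrite ?expr0 ?expr1; ring.
Qed.

Lemma oconj_linear : linear (@oconj R).
Proof. by move=> a x y; apply/rowP => k; rewrite !mxE; case: ifP => // _; ring. Qed.
HB.instance Definition _ :=
  GRing.isLinear.Build R (oct R) (oct R) *:%R (@oconj R) oconj_linear.

Lemma oconj_omul x y : oconj (omul x y) = omul (oconj y) (oconj x).
Proof.
rewrite (oct_basis x) omul_suml !linear_sum; apply: eq_bigr => i _.
rewrite omulZl !linearZ /=; congr (_ *: _).
rewrite (oct_basis y) !linear_sum omul_suml; apply: eq_bigr => j _.
rewrite !linearZ /= omulZl; congr (_ *: _).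
rewrite omul_oe linearZ /= !oconj_oe omulZl (linearZZ (omul (oe R j))) /= omul_oe.
rewrite !scalerA -!signr_addb !oct_negE -!val_eqE /= !val_oct_idx; congr (_ *: oe _ _); last first.
  by apply: val_inj; rewrite /= !val_oct_idx lxorC.
congr (_ ^+ nat_of_bool _); apply/eqP.
by apply: (@all2_iota8 (fun i j : nat => oneg i j (+) (Nat.lxor i j != 0)%N ==
  (j != 0%N) (+) (i != 0%N) (+) oneg j i)); vm_compute.
Qed.

Lemma oconjE x : oconj x = (x 0 0 *+ 2) *: oone R - x.
Proof.
apply/rowP => k; rewrite !mxE; have [->|k0] := eqVneq k 0; first by ring.
by rewrite mulr0 sub0r.
Qed.

Lemma omulDr x y z : omul x (y + z) = omul x y + omul x z.
Proof. exact: raddfD. Qed.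

Lemma omulZr (a : R) x y : omul x (a *: y) = a *: omul x y.
Proof. exact: linearZZ. Qed.

End OctonionAlgebra.

(** * Reflection of Clifford identities *)

(* A pair (c, [:: i1; i2; ...]) stands for the monomial c L_i1 L_i2 ... *)
Definition clif := seq (int * seq nat).

Definition clif_wf (p : clif) := all (fun m => all (fun i => 0 < i < 8)%N m.2) p.

Definition clif_mul (p q : clif) : clif :=
  [seq (a.1 * b.1, a.2 ++ b.2) | a <- p, b <- q].

Definition clif_scale (c : int) (p : clif) : clif := [seq (c * a.1, a.2) | a <- p].

(** The boolean is the parity of the minus signs: one for each transposition, and one from L_i L_i =
    -1 when equal letters cancel. *)
Fixpoint word_insert (i : nat) (w : seq nat) : bool * seq nat :=
  if w is j :: w' then
    if (i < j)%N then (false, i :: w)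
    else if i == j then (true, w')
    else let: (s, v) := word_insert i w' in (~~ s, j :: v)
  else (false, [:: i]).

Fixpoint word_sort (w : seq nat) : bool * seq nat :=
  if w is i :: w' then
    let: (s, v) := word_sort w' in
    let: (s', v') := word_insert i v in (s (+) s', v')
  else (false, [::]).

Fixpoint clif_addm (c : int) (w : seq nat) (p : clif) : clif :=
  if p is (d, v) :: p' then
    if v == w then (c + d, v) :: p' else (d, v) :: clif_addm c w p'
  else [:: (c, w)].

Definition clif_norm (p : clif) : clif :=
  foldr (fun m q => let: (s, v) := word_sort m.2 in
                    clif_addm (if s then - m.1 else m.1) v q) [::] p.

(** The guard [clif_wf] is there because the Clifford relations hold only for indices 1 to 7. *)
Definition clif_is0 (p : clif) := clif_wf p && all (fun m => m.1 == 0) (clif_norm p).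

Section CliffordEval.
Variables (V : zmodType) (L : nat -> V -> V).
Hypothesis LB : forall i x y, L i (x - y) = L i x - L i y.
Hypothesis Lsqr : forall i x, (0 < i < 8)%N -> L i (L i x) = - x.
Hypothesis LC : forall i j x, (0 < i < 8)%N -> (0 < j < 8)%N -> i != j ->
  L i (L j x) = - L j (L i x).

HB.instance Definition _ i := GRing.isZmodMorphism.Build V V (L i) (LB i).

Definition word_eval (w : seq nat) (x : V) : V := foldr L x w.

Lemma word_evalB w : zmod_morphism (word_eval w).
Proof. by elim: w => [|i w IH] x y //=; rewrite IH LB. Qed.
HB.instance Definition _ w := GRing.isZmodMorphism.Build V V (word_eval w) (word_evalB w).

Definition clif_eval (p : clif) (x : V) : V := \sum_(m <- p) word_eval m.2 x *~ m.1.

Lemma clif_evalB p : zmod_morphism (clif_eval p).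
Proof.
move=> x y; rewrite /clif_eval -sumrB; apply: eq_bigr => m _.
by rewrite raddfB mulrzBl.
Qed.

Lemma clif_eval0 p : clif_eval p 0 = 0.
Proof. by rewrite -[X in clif_eval p X](subrr 0) clif_evalB subrr. Qed.

Lemma clif_evalN p x : clif_eval p (- x) = - clif_eval p x.
Proof. by rewrite -[- x]add0r clif_evalB clif_eval0 add0r. Qed.

Lemma clif_evalD p x y : clif_eval p (x + y) = clif_eval p x + clif_eval p y.
Proof. by rewrite -{1}[y]opprK clif_evalB clif_evalN opprK. Qed.

Lemma clif_eval_cat p q x : clif_eval (p ++ q) x = clif_eval p x + clif_eval q x.
Proof. by rewrite /clif_eval big_cat. Qed.

Lemma clif_eval_flatten (ps : seq clif) x :
  clif_eval (flatten ps) x = \sum_(p <- ps) clif_eval p x.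
Proof.
elim: ps => [|p ps IH] /=; first by rewrite /clif_eval !big_nil.
by rewrite clif_eval_cat IH big_cons.
Qed.

Lemma clif_eval_cons c w p x :
  clif_eval ((c, w) :: p) x = word_eval w x *~ c + clif_eval p x.
Proof. by rewrite /clif_eval big_cons. Qed.

Lemma clif_eval_word c w x : clif_eval [:: (c, w)] x = word_eval w x *~ c.
Proof. by rewrite /clif_eval big_seq1. Qed.

Lemma clif_eval_scale c p x : clif_eval (clif_scale c p) x = clif_eval p x *~ c.
Proof.
rewrite /clif_eval big_map mulrz_suml; apply: eq_bigr => m _ /=.
by rewrite mulrC mulrzA.
Qed.

Lemma clif_eval_mul p q x : clif_eval (clif_mul p q) x = clif_eval p (clif_eval q x).
Proof.
rewrite /clif_eval big_allpairs_dep; apply: eq_bigr => a _.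
rewrite raddf_sum mulrz_suml; apply: eq_bigr => b _ /=.
by rewrite raddfMz /word_eval foldr_cat -mulrzA mulrC.
Qed.

Lemma word_insertP i w : (0 < i < 8)%N -> all (fun i => 0 < i < 8)%N w ->
  let: (s, v) := word_insert i w in
  all (fun i => 0 < i < 8)%N v /\
  forall x, L i (word_eval w x) = (if s then - word_eval v x else word_eval v x).
Proof.
move=> i8; elim: w => [|j w IH] /=; first by rewrite i8.
move=> /andP[j8 w8]; case: ltnP => ij /=; first by rewrite i8 j8 w8.
case: eqVneq => [->|nij]; first by split=> // x; rewrite Lsqr.
have := IH w8; case: (word_insert i w) => s v [v8 e] /=; rewrite j8 v8; split=> // x.
by rewrite LC // e; case: (s) => /=; rewrite ?raddfN ?opprK.
Qed.

Lemma word_sortP w : all (fun i => 0 < i < 8)%N w ->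
  let: (s, v) := word_sort w in
  all (fun i => 0 < i < 8)%N v /\
  forall x, word_eval w x = (if s then - word_eval v x else word_eval v x).
Proof.
elim: w => [|i w IH] //= /andP[i8 /IH].
case: (word_sort w) => s v [v8 e].
have := word_insertP i8 v8; case: (word_insert i v) => s' v' [v8' e'].
split=> // x; rewrite e.
by case: (s); rewrite ?raddfN /= e'; case: (s'); rewrite /= ?opprK.
Qed.

Lemma clif_eval_addm c w p x :
  clif_eval (clif_addm c w p) x = word_eval w x *~ c + clif_eval p x.
Proof.
elim: p => [|[d v] p IH] /=; first by rewrite clif_eval_cons.
case: eqP => [->|_]; rewrite !clif_eval_cons; first by rewrite mulrzDr addrA.
by rewrite IH addrCA.
Qed.

Lemma clif_eval_norm p x : clif_wf p -> clif_eval (clif_norm p) x = clif_eval p x.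
Proof.
elim: p => [|[c w] p IH] //= /andP[w8 p8].
have := word_sortP w8; case: (word_sort w) => s v [_ e].
rewrite clif_eval_addm clif_eval_cons IH // e.
by case: (s) => //; rewrite mulrNz mulNrz.
Qed.

Lemma clif_is0P p x : clif_is0 p -> clif_eval p x = 0.
Proof.
move=> /andP[p8 /allP p0]; rewrite -clif_eval_norm // /clif_eval big_seq big1 // => m.
by move=> /p0/eqP ->; rewrite mulr0z.
Qed.

End CliffordEval.

(** * Structure of octonion bimodules *)

Definition sign_of (b : bool) : int := if b then -1 else 1.

Definition clif_e (i : nat) : clif := [:: (1, [:: i])].

(** This encodes left multiplication by the octonion e_i e_j, as opposed to the composite L_i L_j;
    the difference of the two is the left associator. *)
Definition clif_ee (i j : nat) : clif :=
  [:: (sign_of (oneg i j), if i == j then [::] else [:: Nat.lxor i j])].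

(* Twice F_i; the condition a < xor a i selects each line through e_i once. *)
Definition clif_2R (i : nat) : clif :=
  (-1, [:: i]) ::
  [seq (sign_of (oneg a (Nat.lxor a i)), [:: a; Nat.lxor a i])
     | a <- iota 1 7 & (a < Nat.lxor a i)%N && (a != i)].

Definition clif_8Re : clif :=
  (1, [::]) :: [seq (-1, [:: t.1.1; t.1.2; t.2]) | t <- oct_lines].

Definition clif_omega : clif := [:: (1, iota 1 7)].

(* Conjugating by L_k, L_l and L_k L_l kills every monomial that fails to
   commute with one of them. *)
Definition clif_avg (w : seq nat) (k l : nat) (p : clif) : clif :=
  flatten [seq clif_mul (clif_mul [:: (t.1.1, t.1.2 ++ w)] p) [:: (1, t.2)]
    | t <- [:: (1 : int, [::], [::]); (-1 : int, [:: k], [:: k]);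
             (-1 : int, [:: l], [:: l]); (1 : int, [:: k; l], [:: l; k])]].

Definition clif_commutator (p q : clif) : clif :=
  clif_mul p q ++ clif_scale (-1) (clif_mul q p).

Definition clif_sqr (p : clif) := clif_mul p p.

(* In (i, r, k, l), e_k avoids the line through e_i and e_r, and e_l avoids this
   line and the one through e_i and e_k. *)
Definition defect_frames : seq (nat * nat * nat * nat) :=
  [:: (1, 2, 4, 6); (2, 1, 4, 5); (3, 1, 4, 5); (4, 1, 2, 3); (5, 1, 2, 3);
      (6, 1, 2, 3); (7, 1, 2, 3)]%N.

Lemma clif_2R_wf : all (fun i => clif_wf (clif_2R i)) (iota 1 7).
Proof. by vm_compute. Qed.

(** By [assoc_1] the commutator [R_i, L_j] is the left associator of e_i and e_j. Here F_i is seen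
    to have the same commutators, doubled to keep integer coefficients. *)
Lemma clif_2R_commutator : all (fun i => all (fun j => clif_is0
  (clif_scale 2 (clif_ee i j ++ clif_scale (-1) (clif_mul (clif_e i) (clif_e j))) ++
   clif_scale (-1) (clif_commutator (clif_2R i) (clif_e j)))) (iota 1 7)) (iota 1 7).
Proof. by vm_compute. Qed.

(** Averaging the relation [defect_rel] turns the coefficient of D into 16 or -16 and kills the term
    without D, which forces D = 0. *)
Lemma clif_defect_inv : all (fun t : nat * nat * nat * nat =>
  let: (i, r, k, l) := t in
  let w := [:: Nat.lxor i r] in
  clif_is0 (clif_avg w k l (clif_scale 2 (clif_commutator (clif_2R i) (clif_e r)))
    ++ [:: (16 * sign_of (oneg i r), [::])])
  && clif_is0 (clif_avg w k l (clif_commutator (clif_sqr (clif_2R i)) (clif_e r))))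
  defect_frames.
Proof. by vm_compute. Qed.

(* A multiple of [F_1^2, L_2], which vanishes once D = 0. *)
Definition clif_omega_source : clif :=
  clif_mul [:: (1, [:: 4; 5; 3]%N)] (clif_commutator (clif_sqr (clif_2R 1)) (clif_e 2)).

(** Adding to the source its conjugate by L_4, whose inverse is -L_4, leaves 8 (1 + L_1 ... L_7). A
    vanishing source thus makes L_1 ... L_7 act as -1. *)
Lemma clif_omegaE : clif_is0
  (clif_omega_source ++ clif_mul (clif_mul [:: (-1, [:: 4%N])] clif_omega_source) (clif_e 4)
   ++ clif_scale (-8) ((1, [::]) :: clif_omega)).
Proof. by vm_compute. Qed.

(* 2 p = p (1 - w) + p (1 + w), and 1 + w acts as 0 for w = L_1 ... L_7. *)
Definition clif_half0 (p : clif) :=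
  clif_is0 (p ++ clif_scale (-1) (clif_mul p clif_omega)).

(** This is the defining formula of Re multiplied by 24, namely 24 Re = 10 - sum 2 R_i L_i, with F_i
    in place of R_i. *)
Lemma clif_8Re_sum : clif_is0
  ((10, [::]) :: flatten [seq clif_scale (-1) (clif_mul (clif_2R i) (clif_e i)) | i <- iota 1 7]
   ++ clif_scale (-3) clif_8Re).
Proof. by vm_compute. Qed.

Lemma clif_8Re_comm : all (fun i => clif_half0
  (clif_mul (clif_2R i) clif_8Re ++ clif_scale (-2) (clif_mul (clif_e i) clif_8Re)))
  (iota 1 7).
Proof. by vm_compute. Qed.

Lemma clif_8Re_assoc : all (fun i => all (fun j => clif_half0
  (clif_mul (clif_ee i j) clif_8Re ++
   clif_scale (-1) (clif_mul (clif_mul (clif_e i) (clif_e j)) clif_8Re)))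
  (iota 1 7)) (iota 1 7).
Proof. by vm_compute. Qed.

(** Multiplied by 16, this reads x = Re x - sum e_i Re(x e_i) over i > 0. *)
Lemma clif_8Re_decomp : clif_half0
  ((16, [::]) :: clif_scale (-2) clif_8Re ++
   flatten [seq clif_mul (clif_mul (clif_e i) clif_8Re) (clif_2R i) | i <- iota 1 7]).
Proof. by vm_compute. Qed.

Section BimoduleStructure.
Variables (R : realType) (V : normedModType R) (M : BanachOBimodule V).
Implicit Types (x y z : V) (p q : oct R).

HB.instance Definition _ p :=
  GRing.isLinear.Build R V V *:%R (lm M p) (lm_linr M p).
HB.instance Definition _ x :=
  GRing.isLinear.Build R (oct R) V *:%R (rm M x) (rm_linl M x).

Definition lmr x p := lm M p x.
Lemma lmr_linear x : linear (lmr x).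
Proof. by move=> a p q; exact: lm_linl. Qed.
HB.instance Definition _ x := GRing.isLinear.Build R (oct R) V *:%R (lmr x) (lmr_linear x).

Definition rmr p x := rm M x p.
Lemma rmr_linear p : linear (rmr p).
Proof. by move=> a x y; exact: rm_linr. Qed.
HB.instance Definition _ p := GRing.isLinear.Build R V V *:%R (rmr p) (rmr_linear p).

Lemma lmNl p x : lm M (- p) x = - lm M p x.
Proof. exact: (raddfN (lmr x)). Qed.
Lemma lmZl (a : R) p x : lm M (a *: p) x = a *: lm M p x.
Proof. exact: (linearZZ (lmr x)). Qed.
Lemma lm_suml I (r : seq I) (P : pred I) (F : I -> oct R) x :
  lm M (\sum_(i <- r | P i) F i) x = \sum_(i <- r | P i) lm M (F i) x.
Proof. exact: (raddf_sum (lmr x)). Qed.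
Lemma rmDr p x y : rm M (x + y) p = rm M x p + rm M y p.
Proof. exact: (raddfD (rmr p)). Qed.
Lemma rmBr p x y : rm M (x - y) p = rm M x p - rm M y p.
Proof. exact: (raddfB (rmr p)). Qed.
Lemma rmZr p (a : R) x : rm M (a *: x) p = a *: rm M x p.
Proof. exact: (linearZZ (rmr p)). Qed.
Lemma rm_sumr I (r : seq I) (P : pred I) (F : I -> V) p :
  rm M (\sum_(i <- r | P i) F i) p = \sum_(i <- r | P i) rm M (F i) p.
Proof. exact: (raddf_sum (rmr p)). Qed.

Lemma subr_mulr2 x y y' z z' :
  x + y *+ 2 + z = x + y' *+ 2 + z' -> (y - y') *~ 2 + (z - z') = 0.
Proof.
rewrite -!(addrA x) => /addrI/eqP; rewrite -subr_eq0 opprD addrACA => /eqP.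
by rewrite -mulrnBl.
Qed.

Lemma double_eq0 x : x = - x -> x = 0.
Proof.
move=> /eqP; rewrite -addr_eq0 -mulr2n -scaler_nat scaler_eq0 pnatr_eq0 /=.
by move=> /eqP.
Qed.

Lemma mulrz_inj0 x (n : int) : n != 0 -> x *~ n = 0 -> x = 0.
Proof.
by move=> n0; rewrite -scaler_int => /eqP; rewrite scaler_eq0 intr_eq0 (negPf n0) => /eqP.
Qed.

Lemma assocC p q x :
  lm M (omul p q) x - lm M p (lm M q x) = - (lm M (omul q p) x - lm M q (lm M p x)).
Proof. by rewrite assoc_1 assoc_2 assoc_3. Qed.

(** The left associator is antisymmetric in p and q, so it vanishes for p = q. *)
Lemma lm_sqr p x : lm M p (lm M p x) = lm M (omul p p) x.
Proof. by apply/esym/eqP; rewrite -subr_eq0; apply/eqP/double_eq0/assocC. Qed.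

Lemma rm_sqr p x : rm M (rm M x p) p = rm M x (omul p p).
Proof.
by apply/eqP; rewrite -subr_eq0; apply/eqP; rewrite assoc_3 lm_sqr subrr oppr0.
Qed.

Let L (k : nat) := lm M (oe R (inord k)).

Lemma basisB k x y : L k (x - y) = L k x - L k y. Proof. exact: raddfB. Qed.
HB.instance Definition _ k := GRing.isZmodMorphism.Build V V (L k) (basisB k).

Lemma omul_inord i j : (i < 8)%N -> (j < 8)%N ->
  omul (oe R (inord i)) (oe R (inord j)) =
  (-1) ^+ oneg i j *: oe R (inord (Nat.lxor i j)).
Proof. by move=> i8 j8; rewrite omul_oe oct_negE /oct_idx !inordK. Qed.

Lemma oe_inord0 : oe R (inord 0) = oone R.
Proof. by congr (oe _ _); apply: val_inj; rewrite /= inordK. Qed.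

Lemma lm_ee i j x : (0 < i < 8)%N -> (0 < j < 8)%N ->
  lm M (omul (oe R (inord i)) (oe R (inord j))) x = clif_eval L (clif_ee i j) x.
Proof.
move=> /andP[_ i8] /andP[_ j8]; rewrite omul_inord // lmZl clif_eval_word.
rewrite -scaler_int; congr (_ *: _); first by case: (oneg i j).
by case: eqP => [<-|_] //=; rewrite (lxorxx (Ordinal i8)) oe_inord0 lm_one.
Qed.

Lemma omul_inord_sqr i : (0 < i < 8)%N ->
  omul (oe R (inord i)) (oe R (inord i)) = - oone R.
Proof.
move=> /andP[i0 i8]; rewrite omul_inord // (lxorxx (Ordinal i8)) oe_inord0.
by rewrite /oneg eqxx orbb eqn0Ngt i0 /= expr1 scaleN1r.
Qed.

Lemma basis_sqr i x : (0 < i < 8)%N -> L i (L i x) = - x.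
Proof. by move=> i8; rewrite /L lm_sqr omul_inord_sqr // lmNl lm_one. Qed.

Lemma oneg_anticomm i j : (0 < i < 8)%N -> (0 < j < 8)%N -> i != j -> oneg j i = ~~ oneg i j.
Proof.
move=> i8 j8 ij.
have /all2_iota8 : all (fun i => all (fun j => [&& 0 < i, 0 < j & i != j]%N ==>
  (oneg j i == ~~ oneg i j)) (iota 0 8)) (iota 0 8) by vm_compute.
move: i8 j8 => /andP[i0 i8] /andP[j0 j8].
by move=> /(_ (Ordinal i8) (Ordinal j8)) /=; rewrite i0 j0 ij => /eqP.
Qed.

(** In the antisymmetry of the left associator the product terms cancel, since e_j e_i = - e_i e_j;
    what is left is the anticommutation. *)
Lemma basis_anticomm i j x : (0 < i < 8)%N -> (0 < j < 8)%N -> i != j ->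
  L i (L j x) = - L j (L i x).
Proof.
move=> i8 j8 ij; have := assocC (oe R (inord i)) (oe R (inord j)) x.
have -> : omul (oe R (inord j)) (oe R (inord i)) = - omul (oe R (inord i)) (oe R (inord j)).
  case/andP: (i8) => _ i8'; case/andP: (j8) => _ j8'.
  rewrite !omul_inord // (oneg_anticomm i8 j8 ij) -scaleNr (lxorC (Ordinal j8') (Ordinal i8')).
  congr (_ *: _).
  by case: oneg; rewrite /= ?expr1 ?expr0 ?opprK.
by rewrite lmNl opprB opprK addrC => /addIr e; rewrite /L -e opprK.
Qed.

Lemma clif_eval_e k x : clif_eval L (clif_e k) x = L k x.
Proof. by rewrite clif_eval_word. Qed.

Lemma clif_eval_commutator (p q : clif) x : clif_eval L (clif_commutator p q) x =
  clif_eval L p (clif_eval L q x) - clif_eval L q (clif_eval L p x).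
Proof. by rewrite clif_eval_cat clif_eval_scale !(clif_eval_mul basisB) mulrN1z. Qed.

Let is0P := @clif_is0P V L basisB basis_sqr basis_anticomm.

(** * Vanishing of the defect: right multiplications as polynomials in left ones *)

Section Defect.
Variable i : nat.
Hypothesis i8 : (0 < i < 8)%N.
Let r x := rm M x (oe R (inord i)).
(** Twice the defect R_i - F_i, so that all coefficients stay integral. *)
Let D x := r x *+ 2 - clif_eval L (clif_2R i) x.

Let DB : zmod_morphism D.
Proof.
move=> x y; rewrite /D /r rmBr (clif_evalB basisB) mulrnBl !opprB.
by rewrite [X in _ = _ + X]addrC [RHS]addrACA [X in _ = _ + X]addrC.
Qed.
HB.instance Definition _ := GRing.isZmodMorphism.Build V V D DB.

Let F := clif_eval L (clif_2R i).
Let FB : zmod_morphism F.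
Proof. exact: (clif_evalB basisB). Qed.
HB.instance Definition _ := GRing.isZmodMorphism.Build V V F FB.

Let i_in : i \in iota 1 7.
Proof. by rewrite mem_iota. Qed.

Lemma defect_basis j x : (0 < j < 8)%N -> D (L j x) = L j (D x).
Proof.
move=> j8; apply/eqP; rewrite -subr_eq0; apply/eqP.
have j_in : j \in iota 1 7 by rewrite mem_iota.
have /allP/(_ _ i_in)/allP/(_ _ j_in)/(is0P x) := clif_2R_commutator.
rewrite clif_eval_cat !clif_eval_scale clif_eval_cat clif_eval_scale.
rewrite clif_eval_commutator !(clif_eval_mul basisB) !clif_eval_e !mulrN1z => <-.
have e : r (L j x) - L j (r x) = clif_eval L (clif_ee i j) x - L i (L j x).
  by rewrite -lm_ee // /r /L -assoc_1.
rewrite -e /D raddfB /= raddfMn /= pmulrn mulrzBl opprB -/F !opprD !opprK.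
by rewrite [X in _ = _ + X]addrC [RHS]addrACA.
Qed.

Lemma defect_clif (p : clif) x : clif_wf p -> D (clif_eval L p x) = clif_eval L p (D x).
Proof.
move=> p8; rewrite /clif_eval raddf_sum big_seq [RHS]big_seq; apply: eq_bigr => m /(allP p8) m8.
rewrite raddfMz /=; congr (_ *~ _).
elim: m.2 m8 => //= j w IH /andP[j8 /IH <-]; exact: defect_basis.
Qed.

(** Expand (2 R_i)^2 = -4 with 2 R_i = D + F. The mixed terms agree because F is a polynomial in the
    L_j, with which D commutes. *)
Lemma defect_sqr x : D (D x) + F (D x) *+ 2 + F (F x) = - x *+ 4.
Proof.
have DE y : r y *+ 2 = D y + F y by rewrite /D subrK.
have rr : r (r x) = - x by rewrite /r rm_sqr omul_inord_sqr // raddfN /= rm_one.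
have : r (r x *+ 2) *+ 2 = - x *+ 4.
  by rewrite /r -[rm _ _ _]/(rmr _ _) raddfMn /= -[rmr _ _]/(r (r x)) rr -mulrnA.
have DF : D (F x) = F (D x) by rewrite defect_clif // (allP clif_2R_wf).
rewrite DE (DE x) (raddfD D (D x)) (raddfD F (D x)) /= -/D DF => <-.
by rewrite mulr2n !addrA.
Qed.

(** Take the commutator of [defect_sqr] with L_j: D^2 and the constant drop out, leaving the terms
    in F D and F^2. *)
Lemma defect_rel j x : (0 < j < 8)%N ->
  clif_eval L (clif_scale 2 (clif_commutator (clif_2R i) (clif_e j))) (D x) +
  clif_eval L (clif_commutator (clif_sqr (clif_2R i)) (clif_e j)) x = 0.
Proof.
move=> j8; rewrite clif_eval_scale !clif_eval_commutator !(clif_eval_mul basisB) !clif_eval_e -/F.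
have := defect_sqr (L j x).
have -> : - L j x *+ 4 = L j (- x *+ 4) by rewrite raddfMn raddfN.
rewrite -defect_sqr !defect_basis // (raddfD (L j) (D (D x) + _)) (raddfD (L j) (D (D x))).
by rewrite (raddfMn (L j) 2 (F (D x))); apply: subr_mulr2.
Qed.

(** As D commutes with every word in the L_j, multiplying [defect_rel] by words on both sides
    preserves its shape. *)
Lemma defect_avg w k l j x : clif_wf [:: (1, [:: k, l & w])] -> (0 < j < 8)%N ->
  clif_eval L (clif_avg w k l
    (clif_scale 2 (clif_commutator (clif_2R i) (clif_e j)))) (D x) +
  clif_eval L (clif_avg w k l (clif_commutator (clif_sqr (clif_2R i)) (clif_e j))) x = 0.
Proof.
move=> wf j8; rewrite /clif_avg !clif_eval_flatten !big_map -big_split.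
rewrite big_seq big1 // => t t_in; rewrite -[LHS]/(clif_eval L _ (D x) + clif_eval L _ x).
rewrite !(clif_eval_mul basisB _ [:: (1, t.2)]) !(clif_eval_mul basisB [:: (t.1.1, _)]) -defect_clif.
  by rewrite -(clif_evalD basisB) defect_rel // (clif_eval0 basisB).
move: wf t_in; rewrite /= andbT !inE => /and3P[k8 l8 _] /or4P[] /eqP -> /=;
  by rewrite ?k8 ?l8.
Qed.

Lemma defect0 x : D x = 0.
Proof.
have [t tf ti] : exists2 t, t \in defect_frames & t.1.1.1 = i.
  have /allP/(_ _ i_in)/hasP : all (fun i => has (fun t => t.1.1.1 == i) defect_frames) (iota 1 7).
    by vm_compute.
  by move=> [t ? /eqP]; exists t.
have wf : all (fun t : nat * nat * nat * nat => let: (i, r, k, l) := t in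
  clif_wf [:: (1, [:: k; l; Nat.lxor i r])] && (0 < r < 8)%N) defect_frames by vm_compute.
case: t ti tf => [[[i' j] k] l] ti tf; rewrite [i']ti in tf.
have /andP[/(is0P (D x)) e1 /(is0P x) e2] := allP clif_defect_inv _ tf.
have /andP[w8 j8] := allP wf _ tf.
have := defect_avg x w8 j8; rewrite e2 addr0 => e3.
move: e1; rewrite clif_eval_cat e3 add0r clif_eval_word.
by apply: mulrz_inj0; case: oneg.
Qed.

End Defect.

Lemma rm_clif i x : (0 < i < 8)%N ->
  rm M x (oe R (inord i)) *+ 2 = clif_eval L (clif_2R i) x.
Proof. by move=> /(defect0)/(_ x)/eqP; rewrite subr_eq0 => /eqP. Qed.

Lemma sqr_commutator0 i j x : (0 < i < 8)%N -> (0 < j < 8)%N ->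
  clif_eval L (clif_commutator (clif_sqr (clif_2R i)) (clif_e j)) x = 0.
Proof. by move=> i8 j8; rewrite -[RHS](defect_rel i8 x j8) defect0 // (clif_eval0 basisB) add0r. Qed.

Lemma omegaN x : clif_eval L clif_omega x = - x.
Proof.
have s0 y : clif_eval L clif_omega_source y = 0.
  by rewrite (clif_eval_mul basisB) sqr_commutator0 // (clif_eval0 basisB).
have := is0P x clif_omegaE.
rewrite (clif_eval_cat L clif_omega_source) (clif_eval_cat L (clif_mul _ (clif_e 4))).
rewrite (clif_eval_mul basisB _ (clif_e 4)) (clif_eval_mul basisB _ clif_omega_source) !s0.
rewrite (clif_eval0 basisB) !add0r clif_eval_scale.
move=> /(@mulrz_inj0 _ (-8) isT) /eqP.
by rewrite clif_eval_cons mulr1z /= addrC addr_eq0 => /eqP.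
Qed.

Lemma clif_half0P (p : clif) x : clif_half0 p -> clif_eval L p x = 0.
Proof.
move=> /(is0P x); rewrite clif_eval_cat clif_eval_scale (clif_eval_mul basisB) omegaN.
by rewrite (clif_evalN basisB) mulrN1z opprK -mulr2n pmulrn; apply: mulrz_inj0.
Qed.

Lemma sum_imag (G : 'I_8 -> V) :
  \sum_(i <- iota 1 7) G (inord i) = \sum_(i < 8 | i != 0) G i.
Proof.
rewrite -[iota 1 7]/(index_iota 1 8) big_add1 big_mkord.
rewrite [RHS]big_mkcond [RHS]big_ord_recl /= add0r.
apply: eq_bigr => i _; congr G; apply: val_inj.
by rewrite /= inordK //; exact: (ltn_ord i).
Qed.

Lemma reV_scale24 x :
  reV M x *~ 8 *~ 3 =
  x *~ 10 - (\sum_(i < 8 | i != 0) rm M (lm M (oe R i) x) (oe R i)) *+ 2.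
Proof.
rewrite /reV; set S := \sum_(i | _) _.
rewrite -mulrzA -scaler_int scalerBr !scalerA -(scaler_int 10 x) -(scaler_nat 2 S).
by congr (_ *: _ - _ *: _); rewrite rmorphM /=; field.
Qed.

Lemma reV_clif x : reV M x *~ 8 = clif_eval L clif_8Re x.
Proof.
have := is0P x clif_8Re_sum.
rewrite (clif_eval_cons L 10) (clif_eval_cat L (flatten _)) clif_eval_flatten big_map clif_eval_scale.
rewrite (eq_big_seq (fun i => - rm M (L i x) (oe R (inord i)) *+ 2)); last first.
  move=> i; rewrite mem_iota => i8.
  by rewrite clif_eval_scale (clif_eval_mul basisB) clif_eval_e -rm_clif // mulrN1z mulNrn.
rewrite (sum_imag (fun i => - rm M (lm M (oe R i) x) (oe R i) *+ 2)) sumrMnl sumrN.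
rewrite mulrNz addrA => /eqP; rewrite subr_eq0 => /eqP e3.
apply/eqP; rewrite -subr_eq0; apply/eqP/(@mulrz_inj0 _ 3 isT).
by rewrite mulrzBl -e3 mulNrn reV_scale24 subrr.
Qed.

Lemma reV_linear : linear (reV M).
Proof.
move=> a x y; rewrite /reV.
under eq_bigr do rewrite raddfD /= rmDr linearZ /= rmZr.
rewrite big_split -scaler_sumr /= !scalerDr !scalerN opprD addrACA !scalerA.
by congr (_ *: _ - _ *: _ + _); rewrite mulrC.
Qed.
HB.instance Definition _ := GRing.isLinear.Build R V V *:%R (reV M) reV_linear.

Lemma ReV_scale (a : R) x : ReV M x -> ReV M (a *: x).
Proof.
move=> [c s]; split=> [p|p q]; first by rewrite linearZ /= c rmZr.
by rewrite (linearZZ (lm M q)) /= !(linearZZ (lm M _)) /= -scalerBr s scaler0.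
Qed.

Lemma ReV_basis x :
  (forall i, (0 < i < 8)%N -> L i x = rm M x (oe R (inord i))) ->
  (forall i j, (0 < i < 8)%N -> (0 < j < 8)%N ->
     lm M (omul (oe R (inord i)) (oe R (inord j))) x = L i (L j x)) ->
  ReV M x.
Proof.
move=> c s; split=> [p|p q].
  rewrite (oct_basis p) lm_suml linear_sum; apply: eq_bigr => i _.
  rewrite lmZl linearZ /=; congr (_ *: _).
  have [->|i0] := eqVneq i 0; first by rewrite lm_one rm_one.
  by have := c i; rewrite /L inord_val; apply; rewrite ltn_ord lt0n andbT.
apply/eqP; rewrite subr_eq0; apply/eqP.
rewrite (oct_basis p) omul_suml !lm_suml; apply: eq_bigr => i _.
rewrite omulZl !lmZl; congr (_ *: _).
rewrite (oct_basis q) linear_sum !lm_suml linear_sum; apply: eq_bigr => j _.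
rewrite linearZ /= !lmZl linearZ /=; congr (_ *: _).
have [->|i0] := eqVneq i 0; first by rewrite omul1l lm_one.
have [->|j0] := eqVneq j 0; first by rewrite omul1r lm_one.
by have := s i j; rewrite /L !inord_val; apply; rewrite ltn_ord lt0n andbT.
Qed.

Lemma reV_in x : ReV M (reV M x).
Proof.
have -> : reV M x = (8^-1 : R) *: (reV M x *~ 8).
  by rewrite -scaler_int scalerA mulVf ?scale1r // pnatr_eq0.
apply: ReV_scale; rewrite reV_clif; apply: ReV_basis => [i i8|i j i8 j8].
  have i_in : i \in iota 1 7 by rewrite mem_iota.
  have /(clif_half0P x) := allP clif_8Re_comm _ i_in.
  rewrite clif_eval_cat clif_eval_scale !(clif_eval_mul basisB) clif_eval_e.
  rewrite -rm_clif // mulrNz pmulrn -mulrzBl => /(@mulrz_inj0 _ 2 isT)/eqP.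
  by rewrite subr_eq0 => /eqP.
have i_in : i \in iota 1 7 by rewrite mem_iota.
have j_in : j \in iota 1 7 by rewrite mem_iota.
have /allP/(_ _ j_in)/(clif_half0P x) := allP clif_8Re_assoc _ i_in.
rewrite clif_eval_cat clif_eval_scale !(clif_eval_mul basisB) !clif_eval_e.
by rewrite -lm_ee // mulrN1z => /eqP; rewrite subr_eq0 => /eqP.
Qed.

Lemma oct_decomp x : x = \sum_i rm M (reV M (rm M x (oconj (oe R i)))) (oe R i).
Proof.
have := clif_half0P x clif_8Re_decomp.
rewrite (clif_eval_cons L 16) (clif_eval_cat L (clif_scale _ _)) clif_eval_scale -reV_clif.
rewrite clif_eval_flatten big_map.
rewrite (eq_big_seq (fun i => lm M (oe R (inord i)) (reV M (rm M x (oe R (inord i)))) *~ 16));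
  last first.
  move=> i; rewrite mem_iota => i8.
  rewrite !(clif_eval_mul basisB) clif_eval_e -reV_clif -rm_clif //.
  by rewrite (raddfMn (reV M)) /L (raddfMz (lm M _)) (raddfMn (lm M _)) /= pmulrn -mulrzA.
rewrite (sum_imag (fun i => lm M (oe R i) (reV M (rm M x (oe R i))) *~ 16)) -mulrz_suml.
rewrite -mulrzA -[8 * -2]/(- 16) mulrNz -mulNrz -!mulrzDl => /(@mulrz_inj0 _ 16 isT)/eqP.
rewrite addrA addrAC subr_eq0 => /eqP/(canRL (addrK _)) e0.
rewrite [LHS]e0 [RHS](bigD1 0) //= -sumrN; congr (_ + _).
  by rewrite oconj_oe eqxx scale1r !rm_one.
(* For i > 0 the conjugation absorbs the minus sign, and e_i passes to the right of a real
   element. *)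
apply: eq_bigr => i i0; rewrite oconj_oe i0 /= expr1 scaleN1r -(reV_in _).1.
by rewrite (raddfN (rm M x)) (raddfN (reV M)) raddfN.
Qed.

End BimoduleStructure.

(** * The complex slice of an imaginary unit *)

Section ComplexSlice.
Variables (R : realType) (J : oct R).
Hypothesis JS : in_S J.

Definition cj (a b : R) : oct R := a *: oone R + b *: J.

Lemma omul_cj a b c d : omul (cj a b) (cj c d) = cj (a * c - b * d) (a * d + b * c).
Proof.
rewrite /cj omulDl !omulZl omul1l omulDr !omulZr.
rewrite omul1r JS !scalerDr !scalerA scalerN scalerBl scalerDl.
by rewrite [X in _ + X = _]addrC addrACA.
Qed.

(** The conjugate 2 J_0 - J also squares to -1. Comparing imaginary coordinates gives J_0 J_k = 0,
    so a nonzero J_0 would make J real, and no real number has square -1. *)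
Lemma in_S_imag : J 0 0 = 0.
Proof.
have : omul (oconj J) (oconj J) = omul J J.
  by rewrite -oconj_omul JS raddfN /= oconj_oe eqxx scale1r.
have -> : oconj J = cj (J 0 0 *+ 2) (-1) by rewrite oconjE /cj scaleN1r.
have -> : omul J J = cj (-1) 0 by rewrite /cj scale0r addr0 scaleN1r.
rewrite omul_cj => /rowP e.
have [//|J0] := eqVneq (J 0 0) 0.
have Jreal : J = J 0 0 *: oone R.
  apply/rowP => k; have := e k; rewrite !mxE.
  have [->|k0] := eqVneq k 0; first by move=> _; rewrite mulr1.
  rewrite !mulr0 !add0r mul0r => /eqP; rewrite mulf_eq0 => /orP[|/eqP //].
  have -> : J 0 0 *+ 2 * -1 + -1 * (J 0 0 *+ 2) = - (J 0 0 *+ 4) by ring.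
  by rewrite oppr_eq0 mulrn_eq0 (negPf J0).
have := JS; rewrite /in_S Jreal omulZl linearZ /= omul1l scalerA => /rowP/(_ 0).
rewrite !mxE eqxx mulr1 => h; have := sqr_ge0 (J 0 0).
by rewrite expr2 h oppr_ge0 ler10.
Qed.

Lemma in_S_norm : \sum_i J 0 i ^+ 2 = 1.
Proof.
have : omul J J 0 0 = -1 by rewrite JS mxE oeE eqxx.
rewrite Re_omul => e; apply: oppr_inj; rewrite -e -sumrN; apply: eq_bigr => i _.
have [->|i0] := eqVneq i 0; first by rewrite in_S_imag; ring.
by rewrite expr1; ring.
Qed.

Lemma onorm_cj a b : onorm (cj a b) = Num.sqrt (a ^+ 2 + b ^+ 2).
Proof.
congr Num.sqrt.
transitivity (\sum_(i < 8) (a ^+ 2 * (i == 0)%:R + b ^+ 2 * J 0 i ^+ 2)).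
  apply: eq_bigr => i _; rewrite !mxE.
  by have [->|i0] := eqVneq i 0; rewrite ?in_S_imag /=; ring.
rewrite big_split -!mulr_sumr /= in_S_norm mulr1 (bigD1 0) //= big1 ?addr0 ?mulr1 //.
by move=> i /negPf ->.
Qed.

Lemma oconj_cj a b : oconj (cj a b) = cj a (- b).
Proof.
rewrite /cj linearD !linearZ /= oconj_oe eqxx scale1r.
by rewrite (oconjE J) in_S_imag mul0rn scale0r sub0r scalerN scaleNr.
Qed.

Lemma cj10 : cj 1 0 = oone R.
Proof. by rewrite /cj scale1r scale0r addr0. Qed.

Lemma cj01 : cj 0 1 = J.
Proof. by rewrite /cj scale1r scale0r add0r. Qed.

Lemma in_CJ1 : in_CJ J (oone R).
Proof. by exists 1, 0; rewrite scale1r scale0r addr0. Qed.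

Lemma in_CJJ : in_CJ J J.
Proof. by exists 0, 1; rewrite scale0r add0r scale1r. Qed.

Lemma in_CJM p q : in_CJ J p -> in_CJ J q -> in_CJ J (omul p q).
Proof.
move=> [a [b ->]] [c [d ->]]; rewrite -!/(cj _ _) omul_cj.
by exists (a * c - b * d), (a * d + b * c).
Qed.

Lemma in_CJ_inv p : in_CJ J p -> in_CJ J (octinv p).
Proof.
move=> [a [b ->]]; rewrite -/(cj _ _) /octinv oconj_cj.
set n := (_ ^-1); exists (n * a), (n * - b).
by rewrite /cj scalerDr !scalerA.
Qed.

Lemma omul_CJC p q : in_CJ J p -> in_CJ J q -> omul p q = omul q p.
Proof.
move=> [a [b ->]] [c [d ->]]; rewrite -!/(cj _ _) !omul_cj.
by congr cj; ring.
Qed.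

Lemma omul_CJA p q r : in_CJ J p -> in_CJ J q -> in_CJ J r ->
  omul p (omul q r) = omul (omul p q) r.
Proof.
move=> [a [b ->]] [c [d ->]] [e [f ->]]; rewrite -!/(cj _ _) !omul_cj.
by congr cj; ring.
Qed.

Lemma onorm_CJM p q : in_CJ J p -> in_CJ J q -> onorm (omul p q) = onorm p * onorm q.
Proof.
move=> [a [b ->]] [c [d ->]]; rewrite -!/(cj _ _) omul_cj !onorm_cj -sqrtrM.
  by congr Num.sqrt; ring.
by rewrite addr_ge0 ?sqr_ge0.
Qed.

Lemma onormJ : onorm J = 1.
Proof. by rewrite -[in LHS]cj01 onorm_cj expr0n expr1n add0r sqrtr1. Qed.

Lemma omul_octinv p : in_CJ J p -> 0 < onorm p -> omul p (octinv p) = oone R.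
Proof.
move=> [a [b ->]]; rewrite -!/(cj _ _) /octinv linearZ /= oconj_cj omul_cj => n0.
have -> : a * a - b * - b = onorm (cj a b) ^+ 2.
  by rewrite onorm_cj sqr_sqrtr ?addr_ge0 ?sqr_ge0 //; ring.
have -> : a * - b + b * a = 0 by ring.
rewrite /cj scale0r addr0 scalerA mulVf ?scale1r //.
by rewrite expf_neq0 // gt_eqF.
Qed.

Lemma in_CJ_pow p n : in_CJ J p -> in_CJ J (opow p n).
Proof. by move=> pJ; elim: n => [|n IH]; [exact: in_CJ1 | exact: in_CJM]. Qed.

Lemma onorm_one : onorm (oone R) = 1.
Proof. by rewrite -cj10 onorm_cj expr0n expr1n addr0 sqrtr1. Qed.

Lemma onorm_pow p n : in_CJ J p -> onorm (opow p n) = onorm p ^+ n.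
Proof.
move=> pJ; elim: n => [|n IH]; first by rewrite expr0 onorm_one.
by rewrite /opow iterS onorm_CJM ?IH ?exprS //; exact: in_CJ_pow.
Qed.

Lemma onorm_octinv p : in_CJ J p -> 0 < onorm p -> onorm (octinv p) = (onorm p)^-1.
Proof.
move=> pJ p0; apply: (mulfI (lt0r_neq0 p0)).
by rewrite -onorm_CJM ?omul_octinv ?onorm_one ?divff ?lt0r_neq0 //; exact: in_CJ_inv.
Qed.

End ComplexSlice.

(** * Real parts, para-linear maps and extensions *)

Section RealPart.
Variables (R : realType) (V : normedModType R) (M : BanachOBimodule V).
Implicit Types (x y z a b : V) (p q r : oct R) (h g T : V -> V).
Local Notation lm := (lm M).
Local Notation rm := (rm M).
Local Notation reV := (reV M).
Local Notation e := (oe R).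

Lemma lm_real a p : ReV M a -> lm p a = rm a p.
Proof. by case. Qed.

Lemma lm_lm_real a p q : ReV M a -> lm p (lm q a) = lm (omul p q) a.
Proof. by move=> [_ /(_ p q)/eqP]; rewrite subr_eq0 => /eqP. Qed.

Lemma rm_rm_real a p q : ReV M a -> rm (rm a p) q = rm a (omul p q).
Proof.
move=> [_ h]; apply/eqP; rewrite -subr_eq0; apply/eqP.
by rewrite -assoc_2 -assoc_1 h.
Qed.

Lemma lm_rm_real a p q : ReV M a -> lm p (rm a q) = rm a (omul p q).
Proof. by move=> aR; rewrite -!lm_real // lm_lm_real. Qed.

Lemma reV_rm_real a p : ReV M a -> reV (rm a p) = p 0 0 *: a.
Proof.
move=> aR; rewrite [in LHS](oct_basis p) (raddf_sum (rm a)) (raddf_sum reV).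
rewrite (bigD1 0) //= big1 ?addr0; last first.
  move=> j /negPf j0; rewrite (linearZZ (rm a)) (linearZZ reV) /= /Defs.reV.
  under eq_bigr do rewrite lm_rm_real // rm_rm_real //.
  rewrite -(raddf_sum (rm a)) /= sum_imag_sandwich j0 (linearZZ (rm a)) scalerA -scalerBl.
  have -> : 5 / 12 - 1 / 12 * 5 = 0 :> R by field.
  by rewrite scale0r scaler0.
rewrite (linearZZ (rm a)) (linearZZ reV); congr (_ *: _); rewrite /= /Defs.reV.
under eq_bigr do rewrite lm_rm_real // rm_rm_real //.
rewrite -(raddf_sum (rm a)) /= sum_imag_sandwich eqxx (linearZZ (rm a)) scalerA -scalerBl.
have -> : 5 / 12 - 1 / 12 * -7 = 1 :> R by field.
by rewrite scale1r -[e 0]/(oone R) rm_one.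
Qed.

(** On a summand a e_i with a real this is Re(p e_i) = Re(e_i p). The same reduction yields
    [reV_rm_rm] from [Re_omulA]. *)
Lemma reV_comm x p : reV (lm p x) = reV (rm x p).
Proof.
rewrite (oct_decomp M x) (raddf_sum (lm p)) rm_sumr !(raddf_sum reV).
apply: eq_bigr => i _ /=; move: (reV (rm x (oconj (e i)))) (reV_in M (rm x (oconj (e i)))) => a aR.
by rewrite lm_rm_real // (rm_rm_real _ _ aR) !reV_rm_real // Re_omulC.
Qed.

Lemma reV_rm_rm x p q : reV (rm (rm x p) q) = reV (rm x (omul p q)).
Proof.
rewrite (oct_decomp M x) !rm_sumr !(raddf_sum reV).
apply: eq_bigr => i _ /=; move: (reV (rm x (oconj (e i)))) (reV_in M (rm x (oconj (e i)))) => a aR.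
by rewrite !(rm_rm_real _ _ aR) !reV_rm_real // Re_omulA.
Qed.

Lemma reV_lm_lm x p q : reV (lm p (lm q x)) = reV (lm (omul p q) x).
Proof.
apply/esym/eqP; rewrite -subr_eq0 -raddfB /= assoc_1 assoc_2 raddfB /= reV_rm_rm.
by rewrite subrr.
Qed.

(** The components Re(x conj(e_i)) determine x. *)
Lemma reV_rm_inj x y : (forall p, reV (rm x p) = reV (rm y p)) -> x = y.
Proof.
move=> h; rewrite (oct_decomp M x) (oct_decomp M y).
by apply: eq_bigr => i _; rewrite h.
Qed.

Lemma paralinearE T : right_paralinear M T <->
  forall p x, reV (rm (T x) p) = reV (T (rm x p)).
Proof.
split=> h p x; last by rewrite /Bp raddfB /= h subrr.
by apply/eqP; rewrite -subr_eq0 -raddfB; apply/eqP/h.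
Qed.

(** Multiplied on the right by any q, both sides have real part Re T(a (p q)). *)
Lemma paralinear_real T a p : right_paralinear M T -> ReV M a -> T (rm a p) = rm (T a) p.
Proof.
move=> /paralinearE h aR; apply: reV_rm_inj => q.
by rewrite h reV_rm_rm h rm_rm_real.
Qed.

Section Extension.
Variable h : {linear V -> V}.

Lemma oext_real a p : ReV M a -> oext M h (rm a p) = rm (h a) p.
Proof.
move=> aR; rewrite /oext [in RHS](oct_basis p) (raddf_sum (rm _)).
apply: eq_bigr => i _ /=; rewrite rm_rm_real // reV_rm_real // Re_omul_conj.
by rewrite (linearZZ h) rmZr (linearZZ (rm _)).
Qed.

Lemma oext_linear : linear (oext M h).
Proof.
move=> k x y; rewrite /oext scaler_sumr -big_split; apply: eq_bigr => i _ /=.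
by rewrite (rm_linr M _ k x y) (linearP reV) (linearP h) rm_linr.
Qed.

HB.instance Definition _ := GRing.isLinear.Build R V V *:%R (oext M h) oext_linear.

Lemma olif_linear : linear (olif M (reV \o h)).
Proof.
move=> k x y; rewrite /olif scaler_sumr -big_split; apply: eq_bigr => i _ /=.
by rewrite (rm_linr M _ k x y) (linearP h) (linearP reV) rm_linr.
Qed.

HB.instance Definition _ :=
  GRing.isLinear.Build R V V *:%R (olif M (reV \o h)) olif_linear.

(** The sum defining the lift reassembles p as sum Re(e_i p) conj(e_i). *)
Lemma reV_rm_olif x p : reV (rm (olif M (reV \o h) x) p) = reV (h (rm x p)).
Proof.
rewrite rm_sumr (raddf_sum reV).
transitivity (\sum_i reV (h (rm x (omul (e i) p 0 0 *: oconj (e i))))).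
  apply: eq_bigr => i _; rewrite /= rm_rm_real; last exact: reV_in.
  rewrite reV_rm_real; last exact: reV_in.
  by rewrite (linearZZ (rm x)) (linearZZ h) (linearZZ reV).
rewrite -!raddf_sum; congr (reV (h (rm x _))); rewrite [RHS]oct_basis.
by apply: eq_bigr => i _; exact: Re_omul_oe_conj.
Qed.

(** This identifies the regular composition of lif(Re h) and T with lif(Re h T). Para-linearity
    enters through T(a e_i) = T(a) e_i for real a. *)
Lemma reV_rm_oext_olif (T : {linear V -> V}) x p : right_paralinear M T ->
  reV (rm (rcomp M (olif M (reV \o h)) T x) p) = reV (h (T (rm x p))).
Proof.
move=> Tp; rewrite /rcomp /oext rm_sumr (raddf_sum reV).
rewrite [in RHS](oct_decomp M x) rm_sumr !raddf_sum; apply: eq_bigr => i _ /=.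
move: (reV (rm x (oconj (e i)))) (reV_in M (rm x (oconj (e i)))) => a aR.
by rewrite reV_rm_rm reV_rm_olif -paralinear_real // rm_rm_real.
Qed.

End Extension.
End RealPart.

(** * Norm estimates *)

Section Normed.
Variables (R : realType) (V : normedModType R).

Lemma le_opnorm (T : {linear V -> V}) : bounded_op T ->
  forall x, `|T x| <= opnorm T * `|x|.
Proof.
move=> [c cT] x; have [->|x0] := eqVneq x 0; first by rewrite raddf0 !normr0 mulr0.
rewrite -ler_pdivrMr ?normr_gt0 //; apply: ub_le_sup.
  exists `|c| => _ [y /= y1 <-]; apply: le_trans (cT y) _.
  by apply: le_trans (ler_norm _) _; rewrite normrM ler_piMr // normr_id.
exists (`|x|^-1 *: x) => /=; rewrite ?linearZ normrZ normfV normr_id ?mulVf ?normr_eq0 //.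
by rewrite mulrC.
Qed.

Lemma opnorm_ge0 (T : {linear V -> V}) : bounded_op T -> 0 <= opnorm T.
Proof.
move=> [c cT]; apply: ub_le_sup.
  exists `|c| => _ [y /= y1 <-]; apply: le_trans (cT y) _.
  by apply: le_trans (ler_norm _) _; rewrite normrM ler_piMr // normr_id.
by exists 0; rewrite /= ?raddf0 normr0 ?ler01.
Qed.

Lemma iter_bound (T : V -> V) (t : R) n x : 0 <= t ->
  (forall x, `|T x| <= t * `|x|) -> `|iter n T x| <= t ^+ n * `|x|.
Proof.
move=> t0 Tt; elim: n => [|n IH]; first by rewrite mul1r.
by rewrite iterS exprS -mulrA (le_trans (Tt _)) // ler_wpM2l.
Qed.

Lemma bounded_cvg (f : {additive V -> V}) (c : R) (u : nat -> V) (l : V) :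
  (forall x, `|f x| <= c * `|x|) -> u @ \oo --> l -> f \o u @ \oo --> f l.
Proof.
move=> fc ul; apply/cvgrPdist_le => eps eps0; near=> n.
rewrite /= -raddfB; apply: le_trans (fc _) _.
(* The bound c may be zero or negative, whereas |c| + 1 can be divided by. *)
apply: (@le_trans _ _ ((`|c| + 1) * `|l - u n|)).
  by rewrite ler_wpM2r // (le_trans (ler_norm _)) // lerDl.
rewrite mulrC -ler_pdivlMr ?ltr_wpDl //.
near: n; move/cvgrPdist_le: ul; apply.
by rewrite divr_gt0 ?ltr_wpDl.
Unshelve. all: by end_near. Qed.

Lemma series_additive (f : {additive V -> V}) (u : nat -> V) :
  series (f \o u) = f \o series u.
Proof. by apply/funext => n; rewrite /series /= raddf_sum. Qed.

End Normed.

Lemma cvg_series_geom (R : realType) (V : completeNormedModType R) (u : nat -> V)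
  (C r : R) : 0 <= r -> r < 1 -> (forall n, `|u n| <= C * r ^+ n) -> cvgn (series u).
Proof.
move=> r0 r1 ub; apply: normed_cvg.
apply: (@series_le_cvg _ _ (geometric C r)) => [n|n|n|] //.
- exact: normr_ge0.
- exact: le_trans (normr_ge0 _) (ub n).
- exact: ub.
by apply: is_cvg_geometric_series; rewrite ger0_norm.
Qed.

Section NormBounds.
Variables (R : realType) (V : normedModType R) (M : BanachOBimodule V).
Local Notation lm := (lm M).
Local Notation rm := (rm M).
Local Notation reV := (reV M).
Local Notation e := (oe R).

Lemma onorm_oe i : onorm (e i) = 1.
Proof.
rewrite /onorm (bigD1 i) //= big1; first by rewrite oeE eqxx expr1n addr0 sqrtr1.
by move=> j /negPf ji; rewrite oeE ji expr0n.
Qed.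

Lemma onorm_oconj (p : oct R) : onorm (oconj p) = onorm p.
Proof.
congr Num.sqrt; apply: eq_bigr => i _; rewrite mxE.
by case: ifP => // _; rewrite sqrrN.
Qed.

Lemma onorm_ge0 (p : oct R) : 0 <= onorm p.
Proof. exact: sqrtr_ge0. Qed.

(** The weights in [reV] add up to 5/12 + 7 (1/12) = 1 in absolute value. *)
Lemma norm_reV x : `|reV x| <= `|x|.
Proof.
apply: le_trans (ler_normB _ _) _; rewrite !normrZ !ger0_norm //.
apply: (@le_trans _ _ (5 / 12 * `|x| + 1 / 12 * (7 * `|x|))); last first.
  by rewrite le_eqVlt; apply/orP; left; apply/eqP; field.
rewrite lerD2l ler_wpM2l // (le_trans (ler_norm_sum _ _ _)) //.
under eq_bigr do rewrite norm_rm norm_lm !onorm_oe !mul1r.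
by rewrite big_mkcond !big_ord_recl big_ord0 /= add0r addr0; lra.
Qed.

Lemma norm_piJ J x : onorm J = 1 -> `|piJ M J x| <= 2 * `|x|.
Proof.
move=> J1; apply: le_trans (ler_normD _ _) _; rewrite norm_lm J1 mul1r mulr_natl mulr2n.
apply: lerD; first exact: norm_reV.
by apply: le_trans (norm_reV _) _; rewrite norm_lm onorm_oconj J1 mul1r.
Qed.

Lemma norm_sum8 (G : 'I_8 -> V) (c : R) :
  (forall i, `|G i| <= c) -> `|\sum_i G i| <= 8 * c.
Proof.
move=> Gc; apply: le_trans (ler_norm_sum _ _ _) _.
apply: (@le_trans _ _ (\sum_(i < 8) c)); first by apply: ler_sum.
by rewrite sumr_const card_ord mulr_natl.
Qed.

Lemma norm_oext (h : V -> V) c x : 0 <= c -> (forall y, `|h y| <= c * `|y|) ->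
  `|oext M h x| <= 8 * c * `|x|.
Proof.
move=> c0 hc; rewrite -mulrA; apply: norm_sum8 => i.
rewrite norm_rm onorm_oe mul1r (le_trans (hc _)) // ler_wpM2l //.
by rewrite (le_trans (norm_reV _)) // norm_rm onorm_oconj onorm_oe mul1r.
Qed.

Lemma norm_olif (h : V -> V) c x : (forall y, `|h y| <= c * `|y|) ->
  `|olif M h x| <= 8 * c * `|x|.
Proof.
move=> hc; rewrite -mulrA; apply: norm_sum8 => i.
rewrite norm_rm onorm_oe mul1r (le_trans (hc _)) //.
by rewrite norm_rm onorm_oconj onorm_oe mul1r.
Qed.

Lemma piJ_linear J : linear (piJ M J).
Proof.
move=> k x y; rewrite /piJ (linearP (lm (oconj J))) !(linearP reV) (linearP (lm J)).
by rewrite scalerDr addrACA.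
Qed.
HB.instance Definition _ J := GRing.isLinear.Build R V V *:%R (piJ M J) (piJ_linear J).

End NormBounds.

(** * Resolvent series *)

Section IterLinear.
Variables (R : realType) (V : normedModType R) (T : {linear V -> V}).

Lemma iter_linear n : linear (iter n T).
Proof. by elim: n => [|n IH] k x y //=; rewrite IH linearP. Qed.
HB.instance Definition _ n := GRing.isLinear.Build R V V *:%R (iter n T) (iter_linear n).
End IterLinear.

(** * The terms of the two series on the slice of J *)

Section Slice.
Variables (R : realType) (V : normedModType R) (M : BanachOBimodule V).
Variables (J : oct R) (JS : in_S J).
Local Notation lm := (lm M).
Local Notation rm := (rm M).
Local Notation reV := (reV M).

(** Both factors are combinations of 1 and J, so only the associator [x, J, J] could contribute, and
    [rm_sqr] makes it zero. *)
Lemma rm_rm_CJ x p q : in_CJ J p -> in_CJ J q -> rm (rm x p) q = rm x (omul p q).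
Proof.
move=> [a [b ->]] [c [d ->]]; rewrite -!/(cj J _ _) omul_cj // /cj.
rewrite !(raddfD (rm x)) /= !rmDr !(linearZZ (rm x)) /= !rmZr.
rewrite !(raddfD (rm _)) /= !(linearZZ (rm _)) /= !rm_one rm_sqr JS.
rewrite raddfN /= rm_one !scalerDr !scalerA scalerN scalerBl scalerDl.
by rewrite [X in _ + X = _]addrC addrACA.
Qed.

Definition slice_val (h : V -> V) (a b : V) (p : oct R) :=
  rm (h a) p + rm (h b) (omul J p).

Lemma rm_slice a b p : ReV M a -> ReV M b ->
  rm (a + lm J b) p = rm a p + rm b (omul J p).
Proof. by move=> aR bR; rewrite rmDr lm_real // rm_rm_real. Qed.

Lemma oext_slice (h : {linear V -> V}) a b p : ReV M a -> ReV M b ->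
  oext M h (rm a p + rm b (omul J p)) = slice_val h a b p.
Proof. by move=> aR bR; rewrite (raddfD (oext M h)) /= !oext_real. Qed.

(** For x in the slice, p x = x p and B_p(ext h, x) = 0, so the right action reduces to (ext h)(x
    p). *)
Lemma oract_slice (h : {linear V -> V}) a b p : ReV M a -> ReV M b -> in_CJ J p ->
  oract M (oext M h) p (a + lm J b) = slice_val h a b p.
Proof.
move=> aR bR pJ; have JJ := in_CJJ J.
have fp : oext M h (rm (a + lm J b) p) = slice_val h a b p.
  by rewrite rm_slice // oext_slice.
have lp : lm p (a + lm J b) = rm (a + lm J b) p.
  rewrite rm_slice // (raddfD (lm p)) /= lm_real // lm_lm_real // lm_real //.
  by rewrite (omul_CJC JS pJ).
have f1 : oext M h (a + lm J b) = h a + rm (h b) J.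
  rewrite -[a + lm J b](rm_one M) rm_slice // oext_slice //.
  by rewrite /slice_val rm_one omul1r.
rewrite /oract /Bp lp fp f1 rmDr rm_rm_CJ // -/(slice_val h a b p) subrr subr0 //.
Qed.

Lemma comp_assoc_slice (T h : {linear V -> V}) a b p : ReV M a -> ReV M b ->
  comp_assoc M T (oext M h) (rm (a + lm J b) p) =
  slice_val (T \o h) a b p - T (slice_val h a b p).
Proof.
move=> aR bR; rewrite /comp_assoc /rcomp rm_slice // !oext_slice //.
have fR c : ReV M c -> oext M h c = h c.
  by move=> cR; rewrite -[in LHS](rm_one M c) oext_real // rm_one.
by rewrite /slice_val /= !fR.
Qed.

Lemma slice_val_rm h a b p s : in_CJ J p -> in_CJ J s ->
  rm (slice_val h a b p) s = slice_val h a b (omul p s).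
Proof.
move=> pJ sJ; have JJ := in_CJJ J; have JpJ := in_CJM JS JJ pJ.
by rewrite /slice_val rmDr !rm_rm_CJ // (omul_CJA JS JJ).
Qed.

Lemma norm_slice_val (T : V -> V) (t : R) n a b p : 0 <= t ->
  (forall x, `|T x| <= t * `|x|) -> in_CJ J p ->
  `|slice_val (iter n T) a b p| <= (`|a| + `|b|) * (onorm p * t ^+ n).
Proof.
move=> t0 Tt pJ; apply: le_trans (ler_normD _ _) _.
rewrite !norm_rm (onorm_CJM JS (in_CJJ J) pJ) (onormJ JS) mul1r mulrDl.
by apply: lerD; rewrite [leRHS]mulrCA ler_wpM2l ?onorm_ge0 // [leRHS]mulrC iter_bound.
Qed.

(** For h the identity this is pi_J(x p), the minus sign coming from conj(J) = -J; for h =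
    [iter n T] it is the Phi_n that telescopes in part (2). *)
Definition slice_form (h : V -> V) (x : V) (p : oct R) : V :=
  reV (h (rm x p)) - lm J (reV (h (rm x (omul p J)))).

Lemma piJE x : piJ M J x = reV x - lm J (reV (rm x J)).
Proof.
rewrite /piJ; have -> : oconj J = - J by rewrite oconjE (in_S_imag JS) mul0rn scale0r sub0r.
by rewrite (lmNl M) (raddfN reV) (raddfN (lm J)) /= reV_comm.
Qed.

Lemma piJ_rm x p : piJ M J (rm x p) = slice_form id x p.
Proof. by rewrite piJE reV_rm_rm. Qed.

(** With g the lift, pi_J removes the correction term: Re B_p(g, y) vanishes, and so does Re(B_p(g,
    y) J) because p and J lie in one slice. *)
Lemma piJ_olact (h : {linear V -> V}) y p : in_CJ J p ->
  piJ M J (olact M p (olif M (reV \o h)) y) = slice_form h y p.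
Proof.
move=> pJ; have JJ := in_CJJ J; rewrite piJE /olact /Bp.
set g := olif _ _.
have g0 z : reV (g z) = reV (h z).
  by rewrite -[g z](rm_one M) reV_rm_olif rm_one.
rewrite rmDr rmBr !(raddfD reV) !(raddfN reV) /= g0 reV_comm !reV_rm_olif subrr addr0.
rewrite -[reV (rm (lm _ _) _)]reV_comm reV_lm_lm reV_comm reV_rm_rm !reV_rm_olif.
by rewrite rm_rm_CJ // subrr addr0 (omul_CJC JS JJ pJ).
Qed.

Lemma piJ_comp_assoc (h T : {linear V -> V}) x p : right_paralinear M T ->
  piJ M J (rm (comp_assoc M (olif M (reV \o h)) T x) p) =
  slice_form (h \o T) x p - slice_form h (T x) p.
Proof.
move=> Tp; rewrite piJ_rm /slice_form /comp_assoc !rmBr !(raddfB reV) /=.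
rewrite !reV_rm_oext_olif // !reV_rm_olif (raddfB (lm J)) /=.
by rewrite !opprB addrACA [RHS]addrACA [X in _ + X = _]addrC.
Qed.

Lemma norm_slice_form (h : V -> V) (c : R) x p : 0 <= c ->
  (forall y, `|h y| <= c * `|y|) -> in_CJ J p ->
  `|slice_form h x p| <= 2 * `|x| * (onorm p * c).
Proof.
move=> c0 hc pJ; apply: le_trans (ler_normB _ _) _.
rewrite norm_lm (onormJ JS) mul1r -mulrA mulr_natl mulr2n.
have hb r : onorm r = onorm p -> `|reV (h (rm x r))| <= `|x| * (onorm p * c).
  move=> rp; apply: le_trans (norm_reV _ _) _; apply: le_trans (hc _) _.
  by rewrite norm_rm rp le_eqVlt; apply/orP; left; apply/eqP; ring.
by apply: lerD; apply: hb; rewrite // (onorm_CJM JS pJ (in_CJJ J)) (onormJ JS) mulr1.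
Qed.

End Slice.

(** * Convergence and telescoping of the series *)

Section Resolvent.
Variables (R : realType) (V : completeNormedModType R) (M : BanachOBimodule V).
Variables (J s : oct R) (T : {linear V -> V}).
Hypotheses (JS : in_S J) (sJ : in_CJ J s) (Tb : bounded_op T) (Ts : opnorm T < onorm s).
Local Notation lm := (lm M).
Local Notation rm := (rm M).
Local Notation reV := (reV M).
Let t := opnorm T.
Let q := octinv s.
Let r := t / onorm s.

Let t0 : 0 <= t. Proof. exact: opnorm_ge0. Qed.
Let Tt x : `|T x| <= t * `|x|. Proof. exact: le_opnorm. Qed.
Let s0 : 0 < onorm s. Proof. exact: le_lt_trans Ts. Qed.
Let qJ : in_CJ J q. Proof. exact: in_CJ_inv. Qed.
Let pJ n : in_CJ J (opow q n). Proof. exact: in_CJ_pow. Qed.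
Let r0 : 0 <= r. Proof. by rewrite divr_ge0 // ltW. Qed.
Let r1 : r < 1. Proof. by rewrite ltr_pdivrMr // mul1r. Qed.

Let opow_s n : omul (opow q n.+1) s = opow q n.
Proof.
rewrite (omul_CJC JS (pJ _) sJ) /opow iterS -/(opow q n) (omul_CJA JS) //.
by rewrite (omul_octinv JS sJ s0) omul1l.
Qed.

Let pow_bound0 n : onorm (opow q n) * t ^+ n = r ^+ n.
Proof. by rewrite (onorm_pow JS) // (onorm_octinv JS sJ s0) -exprMn mulrC. Qed.

Let pow_bound n : onorm (opow q n.+1) * t ^+ n = (onorm s)^-1 * r ^+ n.
Proof.
rewrite -pow_bound0 mulrA -(onorm_octinv JS sJ s0) -/q.
by rewrite -(onorm_CJM JS qJ (pJ n)).
Qed.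

Lemma right_resolvent_series x : in_CJV M J x ->
  let u := fun n => oract M (circ_pow M T n) (opow q n.+1) x in
  let w := fun n => comp_assoc M T (circ_pow M T n) (rm x (opow q n.+1)) in
  cvgn (series u) /\ cvgn (series w) /\
  Rs M s (limn (series u)) - T (limn (series u)) = x + limn (series w).
Proof.
move=> [a [b [aR [bR ->]]]] u w.
have uE n : u n = slice_val M J (iter n T) a b (opow q n.+1).
  by rewrite /u oract_slice.
(* Multiplication by s lowers the power of q in u_(n+1) from n+2 to n+1, the power occurring in
   u_n. *)
have wE n : w n = rm (u n.+1) s - T (u n).
  by rewrite /w comp_assoc_slice // !uE slice_val_rm // opow_s.
have u0 : rm (u 0) s = a + lm J b.
  rewrite uE slice_val_rm // opow_s /slice_val /= omul1r rm_one.
  by rewrite lm_real.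
have cu : cvgn (series u).
  apply: (@cvg_series_geom _ _ _ ((`|a| + `|b|) * (onorm s)^-1) r) => // n.
  rewrite uE; apply: le_trans (norm_slice_val M JS n a b t0 Tt (pJ n.+1)) _.
  by rewrite -mulrA pow_bound.
have cw : series w @ \oo --> Rs M s (limn (series u)) - T (limn (series u)) - (a + lm J b).
  (* The shifted sum lacks only its first term u_0 s, which is x. *)
  have -> : series w = (fun n => rm (series u n.+1) s - T (series u n) - (a + lm J b)).
    apply/funext => n; rewrite /series /= (eq_bigr _ (fun k _ => wE k)) sumrB.
    rewrite big_nat_recl // rmDr u0 rm_sumr (raddf_sum T) /=.
    by rewrite [RHS]addrAC [X in _ = X - _ - _]addrC addrK.
  apply: cvgB; last exact: cvg_cst; apply: cvgB.
    apply: (@bounded_cvg _ _ (rmr M s) (onorm s) (fun n => series u n.+1)) => [y|].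
      by rewrite /= norm_rm.
    by rewrite (cvg_shiftS (series u)).
  exact: (@bounded_cvg _ _ T t).
split=> //; split; first by apply/cvg_ex; eexists; exact: cw.
by rewrite (cvg_lim _ cw) // [RHS]addrC subrK.
Qed.

Lemma left_resolvent_series (Tp : right_paralinear M T) x :
  let u y := fun n => olact M (opow q n.+1) (pow_circ M T n) y in
  let w := fun n => rm (comp_assoc M (pow_circ M T n) T x) (opow q n.+1) in
  (forall y, cvgn (series (u y))) /\ cvgn (series w) /\
  piJ M J (limn (series (u (Rs M s x - T x)))) = piJ M J x + piJ M J (limn (series w)).
Proof.
move=> u w; have tn n : 0 <= t ^+ n by rewrite exprn_ge0.
have Tn n y : `|iter n T y| <= t ^+ n * `|y| by exact: iter_bound.
have gb n y : `|pow_circ M T n y| <= 8 * t ^+ n * `|y|.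
  by apply: norm_olif => z; apply: le_trans (norm_reV _ _) _.
have cu y : cvgn (series (u y)).
  (* The left action has three summands, each bounded with the factor 8 of [norm_olif]. *)
  apply: (@cvg_series_geom _ _ _ (24 * `|y| * (onorm s)^-1) r) => // n.
  rewrite -[leRHS]mulrA -pow_bound.
  apply: le_trans (ler_normD _ _) _; apply: le_trans (lerD (lexx _) (ler_normB _ _)) _.
  have := gb n y; have := gb n (rm y (opow q n.+1)).
  rewrite norm_lm !norm_rm; have := onorm_ge0 (opow q n.+1).
  move: (onorm _) => P P0 h1 /(ler_wpM2l P0) h2.
  suff : P * `|pow_circ M T n y| + (P * `|pow_circ M T n y| + 
    `|pow_circ M T n (rm y (opow q n.+1))|) <= 
    P * (8 * t ^+ n * `|y|) + (P * (8 * t ^+ n * `|y|) + 8 * t ^+ n * (P * `|y|)).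
    by move=> /le_trans; apply; rewrite le_eqVlt; apply/orP; left; apply/eqP; ring.
  by rewrite !lerD.
have cw : cvgn (series w).
  (* Here 72 = 64 + 8: the regular composition costs an extension on top of a lift, the ordinary one
     just a lift. *)
  apply: (@cvg_series_geom _ _ _ (72 * t * `|x| * (onorm s)^-1) r) => // n.
  rewrite -[leRHS]mulrA -pow_bound norm_rm mulrCA.
  rewrite ler_wpM2l ?onorm_ge0 //; apply: le_trans (ler_normB _ _) _.
  have c0 : 0 <= 8 * t ^+ n * t by rewrite !mulr_ge0.
  have gT z : `|pow_circ M T n (T z)| <= 8 * t ^+ n * t * `|z|.
    by apply: le_trans (gb n _) _; rewrite -[leRHS]mulrA ler_wpM2l ?mulr_ge0.
  apply: le_trans (lerD (norm_oext M x c0 gT) (gT x)) _.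
  by rewrite le_eqVlt; apply/orP; left; apply/eqP; ring.
split=> //; split=> //.
pose psi n := slice_form M J (iter n T) x (opow q n).
have psi_cvg : psi @ \oo --> 0.
  apply/cvgr0Pnorm_le => eps eps0; near=> n.
  apply: le_trans (norm_slice_form M JS x (tn n) (Tn n) (pJ n)) _.
  rewrite pow_bound0.
  apply: le_trans (ler_norm _) _; near: n.
  have /cvgr0Pnorm_le : geometric (2 * `|x|) r @ \oo --> 0.
    by apply: cvg_geometric; rewrite ger0_norm.
  exact.
set y := Rs M s x - T x.
(* Both terms contain -Phi_n(T x, q^(n+1)), which cancels. *)
have uw n : piJ M J (u y n) - piJ M J (w n) = psi n - psi n.+1.
  rewrite /u /w piJ_olact // piJ_comp_assoc //.
  have -> : slice_form M J (iter n T) y (opow q n.+1) =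
      psi n - slice_form M J (iter n T) (T x) (opow q n.+1).
    rewrite /psi /slice_form /y /Rs !rmBr !(raddfB (iter n T)) !(raddfB reV) (raddfB (lm J)) /=.
    have pJJ := in_CJM JS (pJ n.+1) (in_CJJ J).
    rewrite (rm_rm_CJ M JS x sJ (pJ n.+1)) (rm_rm_CJ M JS x sJ pJJ) (omul_CJA JS sJ (pJ _) (in_CJJ J)).
    rewrite (omul_CJC JS sJ (pJ _)) opow_s.
    by rewrite !opprB addrACA [RHS]addrACA [X in _ + X = _]addrC.
  have subrB3 (a b c : V) : a - b - (c - b) = a - c by rewrite opprB addrA subrK.
  by rewrite subrB3 /psi /slice_form /= -!iterSr.
have psi0 : psi 0 = piJ M J x.
  by rewrite /psi /slice_form /= omul1l rm_one piJE.
have piJ_cvg v : cvgn (series v) -> series (piJ M J \o v) @ \oo --> piJ M J (limn (series v)).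
  move=> cv; rewrite series_additive.
  by apply: (@bounded_cvg _ _ (piJ M J) 2) => // z; apply: norm_piJ; exact: onormJ.
apply/eqP; rewrite -subr_eq; apply/eqP.
have d1 := cvgB (piJ_cvg _ (cu y)) (piJ_cvg _ cw).
(* Since pi_J is bounded it passes to the sums, and uniqueness of limits reduces the claim to the
   telescoped partial sums psi_0 - psi_n. *)
suff d2 : series (piJ M J \o u y) - series (piJ M J \o w) @ \oo --> piJ M J x.
  exact: (cvg_unique (@norm_hausdorff _ V) (d1 _) d2).
have -> : series (piJ M J \o u y) - series (piJ M J \o w) = (fun n => piJ M J x - psi n).
  apply/funext => n; rewrite /= -psi0.
  rewrite -[LHS]/(series (piJ M J \o u y) n - series (piJ M J \o w) n) /series /= -sumrB.
  under eq_bigr do rewrite uw.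
  elim: n => [|n IH]; first by rewrite big_geq // subrr.
  by rewrite big_nat_recr //= IH addrA subrK.
rewrite -[X in _ --> X]subr0; apply: cvgB => //; exact: cvg_cst.
Unshelve. all: by end_near. Qed.

End Resolvent.

Theorem mainTheorem1 (R : realType) (V : completeNormedModType R)
    (M : BanachOBimodule V) (T : {linear V -> V})
    (J s : oct R) :
  bounded_op T -> right_paralinear M T ->
  in_S J -> in_CJ J s -> opnorm T < onorm s ->
  (* (1) *)
  (forall x : V, in_CJV M J x ->
     let u := fun n : nat =>
       oract M (circ_pow M T n) (opow (octinv s) n.+1) x in
     let w := fun n : nat =>
       comp_assoc M T (circ_pow M T n) (rm M x (opow (octinv s) n.+1)) in
     cvgn (series u) /\ cvgn (series w) /\
     Rs M s (limn (series u)) - T (limn (series u)) = x + limn (series w))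
  /\
  (* (2) *)
  (forall x : V,
     (forall y : V,
        cvgn (series (fun n : nat =>
                olact M (opow (octinv s) n.+1) (pow_circ M T n) y))) /\
     let w := fun n : nat =>
       rm M (comp_assoc M (pow_circ M T n) T x) (opow (octinv s) n.+1) in
     cvgn (series w) /\
     piJ M J (limn (series (fun n : nat =>
                 olact M (opow (octinv s) n.+1) (pow_circ M T n)
                   (Rs M s x - T x))))
     = piJ M J x + piJ M J (limn (series w))).
Proof.
move=> Tb Tp JS sJ Ts; split=> [x xJ|x]; first exact: (right_resolvent_series JS sJ Tb Ts xJ).
have [cu [cw e]] := left_resolvent_series JS sJ Tb Ts Tp x.
by split.
Qed.
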